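(* Let $(R,\mathfrak{m})$ be a Gorenstein local ring of dimension $d\geq 2$ and let $J=(z_1,\ldots,z_d)$ be an ideal generated by a regular sequence $z_1,\ldots,z_d$ contained in $\mathfrak{m}^s$, where $s\geq 2$ is an integer. For $k=1,\ldots,s$ set $I_k=J\colon\mathfrak{m}^k$ and, for $k=3,\ldots,s$, assume that $\mathfrak{m}^k\colon\mathfrak{m}=\mathfrak{m}^{k-1}$. Let $k\in\{1,\ldots,s\}$, assume that $z_1,\ldots,z_d$ are among the minimal generators of $I_k$, and put $n_k=\lambda(\mathfrak{m}^{k-1}/\mathfrak{m}^k)$ and $\rho=\lambda(S_2(I_k/J))$. Then: (a) the length of the symmetric square $S_2(I_k/J)$ is given by \[ \rho=\lambda(S_2(I_k/J))=\lambda(I_k^2/JI_k)+\lambda(\delta(I_k)), \] where $\delta(I_k)$ is the kernel of the natural surjection $S_2(I_k)\to I_k^2$; (b) the length of the first Koszul homology module $H_1(I_k)$ is given by \[ \lambda(H_1(I_k))=n_k\,\lambda(R/I_k)+\rho-\lambda(R/\mathfrak{m}^k). \] Moreover, $\rho=\binom{n_k+1}{2}$ if and only if $S_2(I_k/J)$ is an $R/\mathfrak{m}$-vector space (that is, is annihilated by $\mathfrak{m}$).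
   Context: All rings are commutative and Noetherian. $\lambda(\cdot)$ denotes length of an $R$-module, $\mathfrak{m}^0=R$, and for ideals $A,B$, $A\colon B=\{r\in R: rB\subseteq A\}$. $S_2(M)$ denotes the second symmetric power of the $R$-module $M$; the natural surjection $S_2(I)\to I^2$ is the one induced by multiplication. ''$z_1,\ldots,z_d$ are among the minimal generators of $I$'' means that they form part of a minimal generating set of $I$. $H_1(I)$ denotes the first homology module of the Koszul complex over $R$ on a minimal generating set of $I$ (up to isomorphism independent of the chosen minimal generating set). *)

(* Defs.v *)
From HB Require Import structures.
From mathcomp Require Import all_boot all_order all_algebra.
From mathcomp Require Import boolp classical_sets.
From mathcomp.multinomials Require Import freeg.

Set Implicit Arguments.
Unset Strict Implicit.
Unset Printing Implicit Defensive.

Import GRing.Theory.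
Local Open Scope ring_scope.
Local Open Scope quotient_scope.

(* A submodule of [M] is an inhabitant of the library type [submodClosed M],
   i.e. a (classically decided) predicate closed under linear combinations;
   submodules are compared extensionally, with [=i] and {subset _ <= _}. *)

Definition mk_submod (R : comNzRingType) (M : lmodType R) (S : {pred M})
    (hS : submod_closed S) : submodClosed M :=
  HB.pack S (GRing.isSubmodClosed.Build R M S hS).

Section Submodules.
Variables (R : comNzRingType) (M N : lmodType R).

Lemma zero_closed : submod_closed (fun x : M => x == 0).
Proof.
split; first exact: eqxx.
by move=> a x y /eqP-> /eqP->; rewrite -topredE /= scaler0 addr0.
Qed.
Definition zeroS := mk_submod zero_closed.

Lemma full_closed : submod_closed (fun _ : M => true).
Proof. by []. Qed.
Definition fullS := mk_submod full_closed.

Lemma cap_closed (A B : submodClosed M) :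
  submod_closed (fun x => (x \in A) && (x \in B)).
Proof.
split; first by rewrite -topredE /= !rpred0.
move=> a x y /andP[xA xB] /andP[yA yB].
by rewrite -topredE /=; apply/andP; split; apply: rpredD => //; apply: rpredZ.
Qed.
Definition capS A B := mk_submod (cap_closed A B).

Lemma span_closed (S : M -> Prop) :
  submod_closed (fun x => `[< forall A : submodClosed M,
                                (forall y, S y -> y \in A) -> x \in A >]).
Proof.
split; first by apply/asboolP => A _; apply: rpred0.
move=> a x y /asboolP hx /asboolP hy; apply/asboolP => A hA.
by apply: rpredD; [apply: rpredZ; apply: hx | apply: hy].
Qed.
Definition spanS S := mk_submod (span_closed S).

Lemma preim_closed (f : {linear M -> N}) (B : submodClosed N) :
  submod_closed (fun x => f x \in B).
Proof.
split; first by rewrite -topredE /= linear0 rpred0.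
by move=> a x y hx hy; rewrite -topredE /= linearP rpredD // rpredZ.
Qed.
Definition preimS f B := mk_submod (preim_closed f B).

Lemma image_closed (f : {linear M -> N}) (A : submodClosed M) :
  submod_closed (fun y => `[< exists2 x, x \in A & y = f x >]).
Proof.
split; first by apply/asboolP; exists 0; rewrite ?rpred0 ?linear0.
move=> a _ _ /asboolP[x xA ->] /asboolP[y yA ->]; apply/asboolP.
by exists (a *: x + y); rewrite ?linearP // rpredD // rpredZ.
Qed.
Definition imageS f A := mk_submod (image_closed f A).

End Submodules.

Arguments zeroS {R} M.
Arguments fullS {R} M.

Definition kerS (R : comNzRingType) (M N : lmodType R) (f : {linear M -> N}) :=
  preimS f (zeroS N).

Section SubMod.
Variables (R : comNzRingType) (M : lmodType R) (A : submodClosed M).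

Definition sub_mod : Type := {x : M | x \in A}.

HB.instance Definition _ := SubChoice.on sub_mod.
HB.instance Definition _ := [SubChoice_isSubLmodule of sub_mod by <:].

End SubMod.

(* The underlying Z-module is the library quotient {ideal_quot zmod_of_submod}. *)
Section QuotMod.
Variables (R : comNzRingType) (M : lmodType R) (A : submodClosed M).

Fact submod_zmod_closed : zmod_closed A.
Proof.
split; first exact: rpred0.
by move=> x y xA yA; rewrite -scaleN1r rpredD // rpredZ.
Qed.
Definition zmod_of_submod : zmodClosed M :=
  HB.pack (A : {pred M}) (GRing.isZmodClosed.Build M (A : {pred M}) submod_zmod_closed).

Definition quot_mod : Type := {ideal_quot zmod_of_submod}.

HB.instance Definition _ := GRing.Zmodule.on quot_mod.

Definition quot_proj (x : M) : quot_mod := \pi_{ideal_quot zmod_of_submod} x.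

Lemma quot_projD : {morph quot_proj : x y / x + y}.
Proof. exact: (raddfD (\pi_{ideal_quot zmod_of_submod})). Qed.

Lemma quot_proj_eq x y : quot_proj x = quot_proj y <-> x - y \in A.
Proof.
rewrite -[x - y \in A]/(x - y \in zmod_of_submod) Quotient.idealrBE.
by split => /eqP.
Qed.

Lemma quot_proj_repr (x : quot_mod) : quot_proj (repr x) = x.
Proof. exact: reprK. Qed.

Definition quot_scale (a : R) (x : quot_mod) : quot_mod :=
  quot_proj (a *: repr x).

Lemma quot_projZ a x : quot_proj (a *: x) = quot_scale a (quot_proj x).
Proof.
apply/quot_proj_eq; rewrite -scalerBr rpredZ //.
by apply/quot_proj_eq; rewrite quot_proj_repr.
Qed.

Fact quot_scaleA a b x : quot_scale a (quot_scale b x) = quot_scale (a * b) x.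
Proof. by rewrite -[x]quot_proj_repr -!quot_projZ scalerA. Qed.
Fact quot_scale1 : left_id 1 quot_scale.
Proof. by move=> x; rewrite -[x]quot_proj_repr -quot_projZ scale1r. Qed.
Fact quot_scaleDr : right_distributive quot_scale +%R.
Proof.
move=> a x y; rewrite -[x]quot_proj_repr -[y]quot_proj_repr.
by rewrite -quot_projD -!quot_projZ -quot_projD scalerDr.
Qed.
Fact quot_scaleDl x : {morph quot_scale^~ x : a b / a + b}.
Proof.
move=> a b; rewrite -[x]quot_proj_repr.
by rewrite -!quot_projZ -quot_projD scalerDl.
Qed.

HB.instance Definition _ := GRing.Zmodule_isLmodule.Build R quot_mod
  quot_scaleA quot_scale1 quot_scaleDr quot_scaleDl.

Fact quot_proj_is_linear : linear quot_proj.
Proof. by move=> a x y; rewrite quot_projD quot_projZ. Qed.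

HB.instance Definition _ :=
  GRing.isLinear.Build R M quot_mod _ quot_proj quot_proj_is_linear.

End QuotMod.

(* [subquo A B] is A / (A :&: B), i.e. A / B when B is contained in A. *)
Definition subquo (R : comNzRingType) (M : lmodType R) (A B : submodClosed M) :
    lmodType R :=
  quot_mod (preimS (\val : {linear sub_mod A -> M}) B).

Section Length.
Variables (R : comNzRingType) (M : lmodType R).

Definition strict_sub (A B : submodClosed M) : Prop :=
  {subset A <= B} /\ ~ {subset B <= A}.

Definition submod_chain (n : nat) : Prop :=
  exists c : nat -> submodClosed M,
    forall i, (i < n)%N -> strict_sub (c i) (c i.+1).

Definition has_length (n : nat) : Prop :=
  submod_chain n /\ forall n', submod_chain n' -> (n' <= n)%N.

Definition finite_length : Prop := exists n, has_length n.

(* Junk value 0 on modules of infinite length. *)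
Definition mlength : nat := xget 0%N [set n | has_length n].

End Length.

Section SymmetricSquare.
Variables (R : comNzRingType) (M : lmodType R).

Definition sym2_gen (u v : M) : {freeg (M * M)%type / R} := << (u, v) >>.

Definition sym2_rel (x : {freeg (M * M)%type / R}) : Prop :=
  (exists a u u' v,
     x = sym2_gen (a *: u + u') v - (a *: sym2_gen u v + sym2_gen u' v)) \/
  (exists u v, x = sym2_gen u v - sym2_gen v u).

Definition sym2 : lmodType R := quot_mod (spanS sym2_rel).

Definition sym2_mk (u v : M) : sym2 := quot_proj _ (sym2_gen u v).

Variables (N : lmodType R) (f : M -> M -> N).

(* The linear map with [sym2_mk u v |-> f u v], for [f] symmetric bilinear. *)
Definition sym2_lift (x : sym2) : N :=
  fglift (fun p : M * M => f p.1 p.2) (repr x).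

Hypotheses (fl : forall v, linear (f^~ v)) (fC : forall u v, f u v = f v u).

Let F := fglift (fun p : M * M => f p.1 p.2).

Lemma sym2_fglift_linear : linear F.
Proof.
have FB : {morph F : x y / x - y} by exact: lift_is_additive.
have F0 : F 0 = 0 by rewrite -(subrr 0) FB subrr.
have FD : {morph F : x y / x + y}.
  by move=> x y; rewrite -[y in LHS]opprK FB -[- y]sub0r FB F0 sub0r opprK.
move=> a x y; rewrite FD; congr (_ + _).
rewrite -[x]freeg_sumE.
elim: (dom x) => [|p s IH]; first by rewrite !big_nil scaler0 F0 scaler0.
rewrite big_cons scalerDr !FD scalerDr IH; congr (_ + _).
have -> : a *: << coeff p x *g p >> = << a * coeff p x *g p >>
    :> {freeg (M * M)%type / R}.
  by apply/eqP/freeg_eqP => q; rewrite coeffZ !coeffU mulrA.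
by rewrite /F !liftU scalerA.
Qed.

Lemma sym2_lift_proj x : sym2_lift (quot_proj _ x) = F x.
Proof.
pose FL : {linear _ -> _} :=
  HB.pack F (GRing.isLinear.Build _ _ _ _ F sym2_fglift_linear).
rewrite /sym2_lift -/F; set y := repr _.
suff : y - x \in kerS FL.
  by rewrite -[_ \in _]/(FL (y - x) == 0) linearB subr_eq0 => /eqP.
have : y - x \in spanS sym2_rel.
  by apply/quot_proj_eq; rewrite quot_proj_repr.
move/asboolP; apply => t [[a [u [u' [v ->]]]]|[u [v ->]]].
  rewrite -[_ \in _]/(FL _ == 0) linearB linearD linearZ /= /F /sym2_gen.
  by rewrite !liftU !scale1r /= fl subrr.
by rewrite -[_ \in _]/(FL _ == 0) linearB /= /F !liftU !scale1r /= fC subrr.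
Qed.

Lemma sym2_lift_is_linear : linear sym2_lift.
Proof.
move=> a x y; rewrite -[x]quot_proj_repr -[y]quot_proj_repr.
by rewrite -linearP !sym2_lift_proj sym2_fglift_linear.
Qed.

Lemma sym2_lift_mk u v : sym2_lift (sym2_mk u v) = f u v.
Proof. by rewrite sym2_lift_proj /F liftU scale1r. Qed.

End SymmetricSquare.

Notation ideal R := (submodClosed (R^o)).

Section Ideals.
Variable R : comNzRingType.
Implicit Types A B I P : ideal R.

Definition ideal_gen (s : seq R) : ideal R := spanS (fun x : R^o => x \in s).

Definition ideal_mul A B : ideal R :=
  spanS (fun x : R^o => exists a b : R, [/\ a \in A, b \in B & x = a * b]).

Fixpoint ideal_exp A (n : nat) : ideal R :=
  if n is n'.+1 then ideal_mul A (ideal_exp A n') else fullS R^o.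

Lemma colon_closed A B :
  submod_closed (fun r : R^o => `[< forall b : R, b \in B -> (r : R) * b \in A >]).
Proof.
split.
  by apply/asboolP => b _; rewrite mul0r; apply: (@rpred0 R^o).
move=> a x y /asboolP hx /asboolP hy; apply/asboolP => b hb.
rewrite mulrDl -mulrA; apply: (@rpredD R^o); last exact: hy.
by apply: (@rpredZ R R^o); apply: hx.
Qed.
Definition colon A B : ideal R := mk_submod (colon_closed A B).

Definition prime_ideal P : Prop :=
  1 \notin P /\ prime_idealr_closed (P : {pred R}).

Definition maximal_ideal I : Prop :=
  1 \notin I /\ forall A, {subset I <= A} -> 1 \notin A -> A =i I.

Definition noetherian : Prop := forall I, exists s : seq R, I =i ideal_gen s.

Definition local_ring (m : ideal R) : Prop :=
  maximal_ideal m /\ forall I, maximal_ideal I -> I =i m.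

Definition prime_chain (n : nat) : Prop :=
  exists p : nat -> ideal R,
    (forall i, (i <= n)%N -> prime_ideal (p i)) /\
    (forall i, (i < n)%N -> strict_sub (p i) (p i.+1)).

Definition krull_dim (d : nat) : Prop :=
  prime_chain d /\ forall n, prime_chain n -> (n <= d)%N.

Definition regular_sequence (z : seq R) : Prop :=
  (forall i (x : R), (i < size z)%N ->
     x * z`_i \in ideal_gen (take i z) -> x \in ideal_gen (take i z)) /\
  1 \notin ideal_gen z.

Definition minimal_generators (s : seq R) I : Prop :=
  I =i ideal_gen s /\
  forall i, (i < size s)%N -> ~ I =i ideal_gen (take i s ++ drop i.+1 s).

Definition among_minimal_generators (z : seq R) I : Prop :=
  exists s, minimal_generators (z ++ s) I.

End Ideals.

Section Gorenstein.
Variable R : comNzRingType.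

Definition injective_module (E : lmodType R) : Prop :=
  forall (M N : lmodType R) (i : {linear M -> N}) (f : {linear M -> E}),
    injective i -> exists g : {linear N -> E}, forall x, g (i x) = f x.

Definition finite_injective_dimension (M : lmodType R) : Prop :=
  exists (n : nat) (E : nat -> lmodType R) (e : {linear M -> E 0%N})
         (d : forall i, {linear E i -> E i.+1}),
    [/\ forall i, injective_module (E i),
        forall i, (n < i)%N -> forall x : E i, x = 0,
        injective e,
        kerS (d 0%N) =i imageS e (fullS M)
      & forall i, kerS (d i.+1) =i imageS (d i) (fullS (E i))].

Definition gorenstein_local (m : ideal R) : Prop :=
  [/\ noetherian R, local_ring m & finite_injective_dimension R^o].

End Gorenstein.

(* The natural surjection S_2(I) -> I^2 induced by multiplication. *)
Section Delta.
Variables (R : comNzRingType) (I : ideal R).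

Fact mul_in_square (x y : sub_mod I) :
  (\val x : R) * (\val y : R) \in ideal_mul I I.
Proof.
apply/asboolP => A; apply; exists (\val x), (\val y).
by split; [exact: valP x | exact: valP y |].
Qed.

Definition square_mul (x y : sub_mod I) : sub_mod (ideal_mul I I) :=
  Sub ((\val x : R) * (\val y : R)) (mul_in_square x y).

Fact square_mul_linear v : linear (square_mul^~ v).
Proof.
by move=> a x y; apply: val_inj; rewrite /= mulrDl -mulrA.
Qed.

Fact square_mulC u v : square_mul u v = square_mul v u.
Proof. by apply: val_inj; rewrite /= mulrC. Qed.

Definition sym2_to_square : sym2 (sub_mod I) -> sub_mod (ideal_mul I I) :=
  sym2_lift square_mul.

HB.instance Definition _ := GRing.isLinear.Build R _ _ _ sym2_to_square
  (sym2_lift_is_linear square_mul_linear square_mulC).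

Lemma sym2_to_square_mk x y :
  \val (sym2_to_square (sym2_mk x y)) = (\val x : R) * (\val y : R).
Proof.
by rewrite /sym2_to_square sym2_lift_mk //;
   [exact: square_mul_linear | exact: square_mulC].
Qed.

Definition delta : lmodType R := sub_mod (kerS sym2_to_square).

End Delta.

(* [koszul_H a p] is the p-th homology of the Koszul complex of R on a.
   The whole exterior algebra of R^n has basis e_A, for A a subset of 'I_n;
   it is represented by coordinates, and its degree p part consists of the
   families supported on the subsets of cardinal p.  The Koszul differential
   e_A |-> \sum_(i in A) (-1)^#|{j in A | j < i}| a_i e_(A \ i)
   reads as follows on coordinates. *)
Section Koszul.
Variables (R : comNzRingType) (n : nat) (a : n.-tuple R).

Definition koszul : lmodType R := {ffun {set 'I_n} -> R^o}.

Definition koszul_d (f : koszul) : koszul :=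
  [ffun B : {set 'I_n} => \sum_(i | i \notin B)
     ((-1) ^+ #|[set j in B | (j < i)%N]| * tnth a i) *: f (i |: B)].

Fact koszul_d_linear : linear koszul_d.
Proof.
move=> c f g; apply/ffunP => B; rewrite !ffunE scaler_sumr -big_split /=.
apply: eq_bigr => i _; rewrite !ffunE scalerDr; congr (_ + _).
by rewrite !scalerA mulrC.
Qed.

HB.instance Definition _ :=
  GRing.isLinear.Build R koszul koszul _ koszul_d koszul_d_linear.

Fact koszul_deg_closed (p : nat) : submod_closed
  (fun f : koszul => [forall A : {set 'I_n}, (#|A| != p) ==> (f A == 0)]).
Proof.
split; first by apply/forallP => A; rewrite ffunE eqxx implybT.
move=> c f g /forallP hf /forallP hg; apply/forallP => A.
apply/implyP => hA; rewrite !ffunE.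
by rewrite (eqP (implyP (hf A) hA)) (eqP (implyP (hg A) hA)) scaler0 addr0.
Qed.
Definition koszul_deg p := mk_submod (koszul_deg_closed p).

Definition koszul_H (p : nat) : lmodType R :=
  subquo (capS (koszul_deg p) (kerS koszul_d))
         (imageS koszul_d (koszul_deg p.+1)).

End Koszul.

(* Main.v *)
(* Write A = R/J. Since z is a regular sequence of length dim R, the only prime
   containing J is m, so A has finite length. From a finite injective resolution
   E of R one gets Ext^i(R/J, R) = 0 for i > d and Ext^d(R/J, R) = R/J (adding
   the z_j one at a time), where Hom(R/K, E_i) is the set of elements of E_i
   killed by K. As R/m embeds in R/J, descending induction on i, starting above
   the length of E, gives Ext^i(R/K, R) = 0 for all i > d and K containing J;
   extending a map defined on a socle element then shows that the socle of A is
   one-dimensional.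

   Type one yields the duality length((J:K)/(J:L)) = length(L/K) for J <= K <= L
   by counting along a composition series. Hence length(I/J) = length(R/m^k) and,
   as J : (J + mI) = m^k : m = m^(k-1), the module I/J needs n_k generators, so
   that I needs d + n_k.

   For (a), the kernel of S_2(I) -> S_2(I/J) consists of the sums of z_j u_j and
   meets delta(I) in 0, because the relations on z are Koszul. For (b), use
   0 -> delta(I) -> H_1(I) -> (R/I)^n -> I/I^2 -> 0 together with
   J/JI = (R/I)^d. The last claim compares S_2(I/J) with S_2(I/J)/m S_2(I/J),
   the symmetric square of a vector space of dimension n_k. *)

Require Import Defs.
From HB Require Import structures.
From mathcomp Require Import all_boot all_order all_algebra.
From mathcomp Require Import boolp classical_sets.
From mathcomp.multinomials Require Import freeg.
From mathcomp Require Import ring zify.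

Set Implicit Arguments.
Unset Strict Implicit.
Unset Printing Implicit Defensive.

Import GRing.Theory.
Local Open Scope ring_scope.

(** * Lengths of intervals of submodules *)

(** Lengths are compared inside a fixed module, between two submodules, so that additivity and
    isomorphisms become statements about chains. Ext never appears as a module: each vanishing or
    generation statement is a chase among elements of the injective resolution, where extending a
    map amounts to solving x h = w.

    Counting along a composition series only gives length((J:K)/(J:L)) <= length(L/K). Equality is
    forced because these bounds, added up from J to R, must reach length(R/J) on both sides.

    The hypothesis on m^k : m starts at k = 3. The case k = 2 rests on m being different from m^2,
    which is derived from d > 0 and from the z_j lying in m^2.

    For (b), put L = length(R/I), q = length(R/m^k), n = d + n_k, f = length(I/I^2) and let e be the
    length of H_1(I) modulo delta(I). The exact sequence gives n L = e + f, while the two chains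
    from JI to I, through J and through I^2, give d L + q = length(I^2/JI) + f. Eliminating f and
    adding length(delta(I)) to e yields the formula, by (a). *)

Section SubmodLattice.
Variables (R : comNzRingType) (M : lmodType R).
Implicit Types A B C : submodClosed M.

Lemma sumS_closed A B :
  submod_closed (fun x => `[< exists2 a, a \in A & x - a \in B >]).
Proof.
split; first by apply/asboolP; exists 0; rewrite ?subr0 rpred0.
move=> r x y /asboolP[a aA aB] /asboolP[b bA bB]; apply/asboolP.
exists (r *: a + b); first by rewrite rpredD ?rpredZ.
by rewrite opprD addrACA -scalerBr rpredD ?rpredZ.
Qed.
Definition sumS A B := mk_submod (sumS_closed A B).

Lemma sumSP A B x : reflect (exists2 a, a \in A & x - a \in B) (x \in sumS A B).
Proof. exact: asboolP. Qed.

Lemma sumSl A B : {subset A <= sumS A B}.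
Proof. by move=> x xA; apply/sumSP; exists x; rewrite ?subrr ?rpred0. Qed.

Lemma sumSr A B : {subset B <= sumS A B}.
Proof. by move=> x xB; apply/sumSP; exists 0; rewrite ?subr0 ?rpred0. Qed.

Lemma spanSP (S : M -> Prop) x :
  x \in spanS S <-> forall A, (forall y, S y -> y \in A) -> x \in A.
Proof. by split=> [/asboolP|h]; last exact/asboolP. Qed.

Lemma mem_spanS (S : M -> Prop) x : S x -> x \in spanS S.
Proof. by move=> Sx; apply/spanSP => A; apply. Qed.

Lemma spanS_sub (S : M -> Prop) A :
  (forall y, S y -> y \in A) -> {subset spanS S <= A}.
Proof. by move=> SA x /spanSP; apply. Qed.

Lemma mem_zeroS x : (x \in zeroS M) = (x == 0).
Proof. by []. Qed.

Lemma mem_fullS x : x \in fullS M.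
Proof. by []. Qed.

Lemma sub_fullS A : {subset A <= fullS M}.
Proof. by []. Qed.

Lemma zeroS_sub A : {subset zeroS M <= A}.
Proof. by move=> x; rewrite mem_zeroS => /eqP->; apply: rpred0. Qed.

Lemma mem_capS A B x : (x \in capS A B) = (x \in A) && (x \in B).
Proof. by []. Qed.

Lemma rpredBZ (S : submodClosed M) x y : x \in S -> y \in S -> x - y \in S.
Proof. by move=> xS yS; rewrite -scaleN1r rpredD ?rpredZ. Qed.

Lemma rpredNZ (S : submodClosed M) x : x \in S -> - x \in S.
Proof. by move=> xS; rewrite -scaleN1r rpredZ. Qed.

End SubmodLattice.

Section LinearSub.
Variables (R : comNzRingType) (M N : lmodType R) (f : {linear M -> N}).

Lemma mem_preimS (B : submodClosed N) x : (x \in preimS f B) = (f x \in B).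
Proof. by []. Qed.

Lemma imageSP (A : submodClosed M) y :
  reflect (exists2 x, x \in A & y = f x) (y \in imageS f A).
Proof. exact: asboolP. Qed.

Lemma mem_kerS x : (x \in kerS f) = (f x == 0).
Proof. by []. Qed.

End LinearSub.

Section IntervalLength.
Variables (R : comNzRingType) (M : lmodType R).
Implicit Types A B C : submodClosed M.

Definition ichain A B n := exists c : nat -> submodClosed M,
  (forall i, (i <= n)%N -> {subset A <= c i} /\ {subset c i <= B}) /\
  forall i, (i < n)%N -> strict_sub (c i) (c i.+1).

(* For [A] contained in [B], this says that B / A has length [n], without
   forming the quotient. *)
Definition ilen A B n := ichain A B n /\ forall n', ichain A B n' -> (n' <= n)%N.

Lemma ilen_inj A B n n' : ilen A B n -> ilen A B n' -> n = n'.
Proof.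
move=> [h1 h2] [h1' h2']; apply/eqP; rewrite eqn_leq.
by rewrite h2' // h2.
Qed.

(** Intersecting a strict chain with a submodule, or adding one to it, may create repetitions; [p]
    marks steps known to stay strict, and only these are counted. *)
Lemma weak_chain A B n (c : nat -> submodClosed M) (p : nat -> bool) :
  (forall i, (i <= n)%N -> {subset A <= c i} /\ {subset c i <= B}) ->
  (forall i, (i < n)%N -> {subset c i <= c i.+1} /\ (p i -> strict_sub (c i) (c i.+1))) ->
  ichain A B (count p (iota 0 n)).
Proof.
move=> cAB cs.
(* The third clause is the induction invariant: the chain extracted so far ends inside [c n], so
   that [c n.+1] can be appended whenever [p n] holds. *)
suff [e [e1 e2 e3]] : exists e : nat -> submodClosed M,
  [/\ forall i, {subset A <= e i} /\ {subset e i <= B},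
      forall i, (i < count p (iota 0 n))%N -> strict_sub (e i) (e i.+1)
    & {subset e (count p (iota 0 n)) <= c n}] by exists e; split.
elim: n cAB cs => [|n IH] cAB cs.
  exists (fun _ => c 0%N); split=> // i; exact: cAB.
have [||e [e1 e2 e3]] := IH.
- by move=> i /leqW; apply: cAB.
- by move=> i /leqW; apply: cs.
rewrite -addn1 iotaD count_cat /= add0n addn0 addnC addn1.
have [sn stn] := cs n (leqnn _).
have [pn|npn] := boolP (p n); last first.
  by rewrite add0n; exists e; split=> // x /e3; apply: sn.
rewrite add1n; set q := count p _ in e2 e3 *.
exists (fun i => if (i <= q)%N then e i else c n.+1); split.
- by move=> i; case: ifP => // _; apply: cAB.
- move=> i; rewrite ltnS leq_eqVlt => /orP[/eqP->|iq].
    rewrite eqxx ltnn; split; first by move=> x /e3; apply: sn.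
    have [_ h] := stn pn.
    by move=> h'; apply: h => x /h'/e3.
  by rewrite iq orbT; apply: e2.
- by rewrite ltnn.
Qed.

Lemma strict_subP A B : {subset A <= B} -> ~ strict_sub A B -> {subset B <= A}.
Proof. by move=> AB nAB; apply: contrapT => h; apply: nAB. Qed.

Lemma ilen0 A B : {subset A <= B} -> {subset B <= A} -> ilen A B 0.
Proof.
move=> AB BA; split; first by exists (fun _ => A); split=> // i _; split.
move=> [//|n] [c [cAB cs]].
have [_ []] := cs 0%N isT; move=> x xc; have [h _] := cAB 0%N isT.
by apply: h; apply: BA; have [_ h'] := cAB 1%N isT; apply: h'.
Qed.

Lemma ilen0P A B : {subset A <= B} -> ilen A B 0 -> {subset B <= A}.
Proof.
move=> AB [_ h]; apply: strict_subP => // sAB.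
suff /h : ichain A B 1 by [].
exists (fun i => if i is 0%N then A else B); split=> [[|i] _|[|i] //].
  by split.
by split.
Qed.

Lemma ilen_gt0 A B n : {subset A <= B} -> ~ {subset B <= A} -> ilen A B n -> (0 < n)%N.
Proof. by case: n => // AB nBA /ilen0P h; case: nBA; apply: h. Qed.

Lemma ichain_cat A B C n p : {subset A <= B} -> {subset B <= C} ->
  ichain A B n -> ichain B C p -> ichain A C (n + p).
Proof.
move=> AB BC [c [c1 c2]] [e [e1 e2]].
pose g i := if (i < n)%N then c i else e (i - n)%N.
exists g; rewrite /g; split=> i hi.
  case: ltnP => [/ltnW/c1[h1 h2]|ni]; first by split=> // x /h2/BC.
  have [|h1 h2] := e1 (i - n)%N; first by rewrite leq_subLR.
  by split=> // x /AB/h1.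
case: (ltngtP i.+1 n) => [h|h|h].
- by apply: c2; apply: ltnW.
- rewrite subSn //; apply: e2.
  by rewrite ltn_subLR.
- rewrite h subnn.
  have [|h1 h2] := c2 i; first by rewrite h.
  have [|_ h3] := c1 i.+1; first by rewrite h.
  have [h4 _] := e1 0%N isT.
  split=> [x /h1/h3/h4 //|h5].
  by apply: h2 => x xc; apply: h5; apply: h4; apply: h3.
Qed.

(** Every strict step of the chain stays strict after intersecting with [B] or after adding [B], so
    [n] is at most the sum of the two counts. *)
Lemma ichain_split A B C n : {subset A <= B} -> {subset B <= C} ->
  ichain A C n -> exists a b, [/\ ichain A B a, ichain B C b & (n <= a + b)%N].
Proof.
move=> AB BC [c [c1 c2]].
pose p i := `[< strict_sub (capS (c i) B) (capS (c i.+1) B) >].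
pose q i := `[< strict_sub (sumS (c i) B) (sumS (c i.+1) B) >].
exists (count p (iota 0 n)), (count q (iota 0 n)); split.
- apply: (@weak_chain _ _ _ (fun i => capS (c i) B)).
    move=> i /c1[h1 h2]; split=> x; rewrite mem_capS; last by case/andP.
    by move=> xA; rewrite h1 // AB.
  move=> i /c2[h1 h2]; split=> [x|/asboolP //].
  by rewrite !mem_capS => /andP[/h1-> ->].
- apply: (@weak_chain _ _ _ (fun i => sumS (c i) B)).
    move=> i /c1[h1 h2]; split=> x; first exact: sumSr.
    by case/sumSP=> a /h2 aC /BC xC; rewrite -(subrK a x) rpredD.
  move=> i /c2[h1 h2]; split=> [x|/asboolP //].
  by case/sumSP=> a /h1 aC xC; apply/sumSP; exists a.
- rewrite -[leqLHS](size_iota 0) -(count_predT (iota 0 n)).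
  have -> : (count p (iota 0 n) + count q (iota 0 n) = count (predU p q) (iota 0 n) +
     count (predI p q) (iota 0 n))%N by rewrite count_predUI.
  apply: leq_trans (leq_addr _ _); rewrite leq_eqVlt; apply/orP; left; apply/eqP.
  apply: eq_in_count => i; rewrite mem_iota add0n => /andP[_ /c2[h1 h2]] /=.
  apply/esym/negPn/negP; rewrite negb_or => /andP[/asboolPn np /asboolPn nq].
  have {}np : {subset capS (c i.+1) B <= capS (c i) B}.
    apply: strict_subP np => x; rewrite !mem_capS => /andP[/h1-> ->] //.
  have {}nq : {subset sumS (c i.+1) B <= sumS (c i) B}.
    apply: strict_subP nq => x /sumSP[a /h1 aC xa]; by apply/sumSP; exists a.
  (* Modular law: an element of [c i.+1] differs from one of [c i] by an element of [B], and that
     difference lies in [c i] too. *)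
  apply: h2 => x xc; have /nq/sumSP[a ac xaB] := sumSl B xc.
  rewrite -(subrK a x) rpredD //.
  have : x - a \in capS (c i.+1) B by rewrite mem_capS xaB rpredBZ // h1.
  by move/np; rewrite mem_capS => /andP[].
Qed.

Lemma ilen_add A B C a b : {subset A <= B} -> {subset B <= C} ->
  ilen A B a -> ilen B C b -> ilen A C (a + b).
Proof.
move=> AB BC [a1 a2] [b1 b2]; split; first exact: ichain_cat a1 b1.
move=> n /(ichain_split AB BC)[a' [b' [/a2 ha /b2 hb hn]]].
by apply: leq_trans hn _; apply: leq_add.
Qed.

Lemma ichain0 A B : {subset A <= B} -> ichain A B 0.
Proof. by move=> AB; exists (fun _ => A); split=> // i _; split. Qed.

Lemma ilen_ex A B n : {subset A <= B} -> (forall n', ichain A B n' -> (n' <= n)%N) ->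
  exists2 l, ilen A B l & (l <= n)%N.
Proof.
move=> AB h.
have ex : exists i, `[< ichain A B i >] by exists 0%N; apply/asboolP/ichain0.
have [|l /asboolP hl lmax] := @ex_maxnP (fun i => `[< ichain A B i >]) n ex.
  by move=> i /asboolP/h.
exists l; last exact: h.
by split=> // n' hn'; apply: lmax; apply/asboolP.
Qed.

Lemma ilen_split A B C n : {subset A <= B} -> {subset B <= C} ->
  ilen A C n -> exists a b, [/\ ilen A B a, ilen B C b & n = (a + b)%N].
Proof.
move=> AB BC hn.
have [a ha _] : exists2 l, ilen A B l & (l <= n)%N.
  apply: ilen_ex => // n' h; have [_ + ] := hn; apply.
  by rewrite -(addn0 n'); apply: ichain_cat h (ichain0 BC).
have [b hb _] : exists2 l, ilen B C l & (l <= n)%N.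
  apply: ilen_ex => // n' h; have [_ + ] := hn; apply.
  by rewrite -(add0n n'); apply: ichain_cat (ichain0 AB) h.
by exists a, b; split=> //; apply: ilen_inj hn _; apply: ilen_add ha hb.
Qed.

Lemma has_lengthP n : has_length M n <-> ilen (zeroS M) (fullS M) n.
Proof.
have h i : submod_chain M i <-> ichain (zeroS M) (fullS M) i.
  split=> [[c hc]|[c [_ hc]]]; exists c => //.
  split=> // j _; split=> // x; rewrite mem_zeroS => /eqP->; exact: rpred0.
by split=> -[/h h1 h2]; split=> // n' /h/h2.
Qed.

Lemma mlengthE n : has_length M n -> mlength M = n.
Proof.
move=> hn; apply: xget_unique => // n' /has_lengthP h'.
by apply: ilen_inj h' _; apply/has_lengthP.
Qed.

End IntervalLength.

(** * Lengths of isomorphic subquotients *)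

Section Transfer.
Variables (R : comNzRingType) (M N : lmodType R) (f : {linear M -> N}).
Variables (A B : submodClosed M) (A' B' : submodClosed N).
Hypotheses (AB : {subset A <= B}) (AB' : {subset A' <= B'}).
Hypotheses (fB : forall x, x \in B -> f x \in B').
Hypotheses (fA : forall x, x \in B -> (f x \in A') = (x \in A)).
Hypotheses (fs : forall y, y \in B' -> exists2 x, x \in B & y - f x \in A').

Lemma ichain_pull n : ichain A' B' n -> ichain A B n.
Proof.
move=> [c [c1 c2]]; exists (fun i => capS (preimS f (c i)) B); split=> i hi.
  have [h1 h2] := c1 i hi; split=> x; rewrite mem_capS; last by case/andP.
  by move=> xA; rewrite (AB xA) andbT mem_preimS h1 // fA // AB.
have [h1 h2] := c2 i hi; split.
  by move=> x; rewrite !mem_capS !mem_preimS => /andP[/h1-> ->].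
move=> h3; apply: h2 => y yc.
have [_ h4] := c1 i.+1 hi; have [h5 _] := c1 i (ltnW hi).
have [h6 _] := c1 i.+1 hi.
have [x xB yx] := fs (h4 _ yc).
have : x \in capS (preimS f (c i.+1)) B.
  by rewrite mem_capS xB mem_preimS -(subKr y (f x)) rpredBZ // h6.
by move/h3; rewrite mem_capS mem_preimS => /andP[xc _]; rewrite -(subrK (f x) y) rpredD // h5.
Qed.

Lemma ichain_push n : ichain A B n -> ichain A' B' n.
Proof.
move=> [c [c1 c2]]; exists (fun i => sumS (imageS f (c i)) A'); split=> i hi.
  have [h1 h2] := c1 i hi; split=> x; first exact: sumSr.
  case/sumSP=> _ /imageSP[a /h2 aB ->] /AB' xa.
  by rewrite -(subrK (f a) x) rpredD // fB.
have [h1 h2] := c2 i hi; split.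
  move=> x /sumSP[_ /imageSP[a /h1 aB ->] xa]; apply/sumSP.
  by exists (f a) => //; apply/imageSP; exists a.
move=> h3; apply: h2 => x xc.
have /h3/sumSP[_ /imageSP[a ac ->]] : f x \in sumS (imageS f (c i.+1)) A'.
  by apply: sumSl; apply/imageSP; exists x.
have [_ h4] := c1 i.+1 hi; have [h5 h6] := c1 i (ltnW hi).
have xaB : x - a \in B by apply: rpredBZ; [apply: h4|apply: h6].
by rewrite -linearB fA // => /h5 h; rewrite -(subrK a x) rpredD.
Qed.

(** The section hypotheses state that [f] induces an isomorphism from B / A to B' / A': [fB] gives
    the target, [fA] makes the map well defined and injective, [fs] makes it onto. *)
Lemma ilen_transfer n : ilen A B n <-> ilen A' B' n.
Proof.
split=> -[h1 h2]; split.
- exact: ichain_push.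
- by move=> n' /ichain_pull/h2.
- exact: ichain_pull.
- by move=> n' /ichain_push/h2.
Qed.

End Transfer.

Section LengthDict.
Variables (R : comNzRingType) (M : lmodType R).
Implicit Types A B : submodClosed M.

Lemma ilen_sub_mod A n : has_length (sub_mod A) n <-> ilen (zeroS M) A n.
Proof.
rewrite has_lengthP; apply: (ilen_transfer (f := \val : {linear sub_mod A -> M})).
- by [].
- by move=> x; rewrite mem_zeroS => /eqP->; apply: rpred0.
- by move=> x _; apply: valP.
- by move=> x _; rewrite !mem_zeroS -(inj_eq val_inj) linear0.
- by move=> y yA; exists (Sub y yA); rewrite ?SubK // subrr rpred0.
Qed.

Lemma ilen_quot_mod A n : has_length (quot_mod A) n <-> ilen A (fullS M) n.
Proof.
rewrite has_lengthP; apply: iff_sym.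
apply: (ilen_transfer (f := quot_proj A : {linear M -> quot_mod A})) => //.
- move=> x _; rewrite mem_zeroS; apply/eqP/idP.
    by rewrite -(linear0 (quot_proj A : {linear _ -> _})) => /quot_proj_eq; rewrite subr0.
  by move=> xA; rewrite -(linear0 (quot_proj A : {linear _ -> _})); apply/quot_proj_eq; rewrite subr0.
- move=> y _; exists (repr y) => //.
  by rewrite [X in y - X](quot_proj_repr y) subrr rpred0.
Qed.

Lemma quot_proj_scale A (a : R) x : quot_proj A (a *: x) = a *: quot_proj A x.
Proof. exact: quot_projZ. Qed.

Lemma quot_proj0 A x : (quot_proj A x == 0) = (x \in A).
Proof.
apply/eqP/idP; rewrite -(linear0 (quot_proj A : {linear _ -> _})).
  by move/quot_proj_eq; rewrite subr0.
by move=> xA; apply/quot_proj_eq; rewrite subr0.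
Qed.

End LengthDict.

Section SubquoLength.
Variables (R : comNzRingType) (M : lmodType R).
Implicit Types A B : submodClosed M.

Lemma ilen_subquo A B n : {subset A <= B} -> has_length (subquo B A) n <-> ilen A B n.
Proof.
move=> AB; apply: iff_trans (ilen_quot_mod _ n) _.
apply: (ilen_transfer (f := \val : {linear sub_mod B -> M})) => //.
- by move=> x _; apply: valP.
- by move=> y yA; exists (Sub y yA); rewrite ?SubK // subrr rpred0.
Qed.

Lemma ilen_eq A B A' B' n : A =i A' -> B =i B' -> {subset A <= B} ->
  ilen A B n -> ilen A' B' n.
Proof.
move=> eA eB AB.
suff /iffLR h : ilen A B n <-> ilen A' B' n by apply: h.
apply: (ilen_transfer (f := idfun : {linear M -> M})) => //.
- by move=> x; rewrite -eA -eB; apply: AB.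
- by move=> x; rewrite eB.
- by move=> y; rewrite -eB => yB; exists y; rewrite // subrr rpred0.
Qed.

End SubquoLength.

(** * Lengths of cyclic and free subquotients *)

Section FreeLength.
Variables (R : comNzRingType) (M : lmodType R).

Definition lin_of (v : M) (r : R^o) : M := r *: v.
Lemma lin_of_is_linear v : linear (lin_of v).
Proof. by move=> a x y; rewrite /lin_of scalerDl scalerA. Qed.
HB.instance Definition _ v :=
  GRing.isLinear.Build R R^o M _ (lin_of v) (lin_of_is_linear v).

Definition line (v : M) := imageS (lin_of v : {linear R^o -> M}) (fullS R^o).

Lemma lineP v x : reflect (exists r : R, x = r *: v) (x \in line v).
Proof.
by apply: (iffP (imageSP _ _ _)) => [[r _ ->]|[r ->]]; exists r.
Qed.

Lemma mem_line v : v \in line v.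
Proof. by apply/lineP; exists 1; rewrite scale1r. Qed.

Lemma ilen_line (A : submodClosed M) v (K : ideal R) l :
  (forall r : R, (r *: v \in A) = (r \in K)) ->
  ilen K (fullS R^o) l <-> ilen A (sumS A (line v)) l.
Proof.
move=> hK; apply: (ilen_transfer (f := lin_of v : {linear R^o -> M})) => //.
- exact: sumSl.
- by move=> r _; apply: sumSr; apply/lineP; exists r.
- by move=> r _; apply: hK.
- move=> y /sumSP[a aA /lineP[r er]]; exists r => //.
  by rewrite [X in y - X](_ : _ = y - a) ?subKr // er.
Qed.

Variables (T : finType) (v : T -> M).

Lemma span_fam_closed (A : submodClosed M) (s : seq T) :
  submod_closed (fun x => `[< exists c : T -> R, x - \sum_(t <- s) c t *: v t \in A >]).
Proof.
split.
  apply/asboolP; exists (fun _ => 0).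
  by rewrite big1 ?subrr ?rpred0 // => i _; rewrite scale0r.
move=> r x y /asboolP[c hc] /asboolP[e he]; apply/asboolP.
exists (fun t => r * c t + e t).
have -> : r *: x + y - \sum_(t <- s) (r * c t + e t) *: v t =
  r *: (x - \sum_(t <- s) c t *: v t) + (y - \sum_(t <- s) e t *: v t).
  rewrite scalerBr addrACA -opprD; congr (_ - _).
  rewrite scaler_sumr -big_split /=; apply: eq_bigr => t _.
  by rewrite scalerDl scalerA.
by rewrite rpredD ?rpredZ.
Qed.
Definition span_fam A s := mk_submod (span_fam_closed A s).

Lemma span_famP (A : submodClosed M) s x :
  reflect (exists c : T -> R, x - \sum_(t <- s) c t *: v t \in A) (x \in span_fam A s).
Proof. exact: asboolP. Qed.

(* The hypotheses say that B / A is isomorphic to (R / K) ^ T. *)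
Lemma ilen_free (A B : submodClosed M) (K : ideal R) l :
  ilen K (fullS R^o) l ->
  {subset A <= B} ->
  (forall t, v t \in B) ->
  (forall x, x \in B -> exists c : T -> R, x - \sum_t c t *: v t \in A) ->
  (forall t (r : R), r \in K -> r *: v t \in A) ->
  (forall c : T -> R, \sum_t c t *: v t \in A -> forall t, c t \in K) ->
  ilen A B (#|T| * l).
Proof.
move=> hl AB vB vs vK vi.
suff h s : uniq s -> ilen A (span_fam A s) (size s * l).
  rewrite cardT; have /h := enum_uniq T; apply: ilen_eq => //.
    move=> x; apply/span_famP/idP => [[c]|xB]; rewrite ?big_enum.
      move=> h'; rewrite -(subrK (\sum_t c t *: v t) x) rpredD //; first exact: AB.
      by apply: rpred_sum => t _; rewrite rpredZ.
    by have [c hc] := vs _ xB; exists c; rewrite big_enum.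
  by move=> x xA; apply/span_famP; exists (fun _ => 0); rewrite big1 ?subr0 // => t _; rewrite scale0r.
elim: s => [|t s IH] /=.
  move=> _; rewrite mul0n; apply: ilen0 => x.
    by move=> xA; apply/span_famP; exists (fun _ => 0); rewrite big_nil subr0.
  by case/span_famP=> c; rewrite big_nil subr0.
move=> /andP[ts us].
have sub1 : {subset A <= span_fam A s}.
  by move=> x xA; apply/span_famP; exists (fun _ => 0); rewrite big1 ?subr0 // => i _; rewrite scale0r.
rewrite mulSn addnC.
have E : sumS (span_fam A s) (line (v t)) =i span_fam A (t :: s).
  move=> x; apply/sumSP/span_famP => [[a /span_famP[c hc] /lineP[r er]]|[c]].
    exists (fun i => if i == t then r else c i).
    rewrite big_cons eqxx -er.
    have -> : \sum_(j <- s) (if j == t then r else c j) *: v j = \sum_(j <- s) c j *: v j.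
      rewrite !big_seq; apply: eq_bigr => j js; case: eqP => // ej.
      by rewrite ej (negbTE ts) in js.
    by rewrite opprD addrA subKr.
  rewrite big_cons => hc; exists (x - c t *: v t).
    by apply/span_famP; exists c; rewrite -addrA -opprD.
  by rewrite subKr; apply/lineP; exists (c t).
have sub2 : {subset span_fam A s <= sumS (span_fam A s) (line (v t))} by exact: sumSl.
suff : ilen A (sumS (span_fam A s) (line (v t))) (size s * l + l).
  by apply: ilen_eq => // x /sub1/sub2.
apply: ilen_add sub1 sub2 (IH us) _.
apply/(ilen_line (K := K)); last exact: hl.
move=> r; apply/span_famP/idP => [[c hc]|rK]; last first.
  exists (fun _ => 0); rewrite big1 ?subr0 ?vK // => i _; by rewrite scale0r.
(* Turns a relation over [t :: s] into one over all of [T], with coefficient [r] at [t] and zeros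
   outside, as [vi] expects. *)
pose c' i := if i == t then r else if i \in s then - c i else 0.
have /vi/(_ t) : \sum_t c' t *: v t \in A.
  rewrite (bigD1 t) //= /c' eqxx.
  suff -> : \sum_(i | i != t) (if i == t then r else if i \in s then - c i else 0) *: v i
      = - \sum_(i <- s) c i *: v i by [].
  rewrite -sumrN [RHS]big_uniq //= [LHS](bigID (mem s)) /= [X in _ + X]big1 ?addr0; last first.
    by move=> i /andP[/negbTE-> /negbTE->]; rewrite scale0r.
  apply: eq_big => i; first by case: eqVneq => // ->; rewrite (negbTE ts).
  by move=> /andP[/negbTE-> ->]; rewrite scaleNr.
by rewrite /c' eqxx.
Qed.

End FreeLength.

Section FinGenLength.
Variables (R : comNzRingType) (M : lmodType R).

(** Adding the generators one at a time, each step is cyclic and killed by [J], hence a quotient of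
    R / J. Generation is stated relative to [A] so that the induction can enlarge [A]. *)
Lemma ilen_fg (A : submodClosed M) (J : ideal R) N (s : seq M) :
  ilen J (fullS R^o) N ->
  (forall x (r : R), r \in J -> r *: x \in A) ->
  (forall B : submodClosed M, {subset A <= B} -> (forall x, x \in s -> x \in B) -> forall x, x \in B) ->
  exists l, ilen A (fullS M) l.
Proof.
move=> hN; elim: s A => [|v s IH] A JA gen.
  by exists 0%N; apply: ilen0 => // x _; apply: gen.
have [|B sB vB|l hl] := IH (sumS A (line v)).
- by move=> x r rJ; apply: sumSl; apply: JA.
- apply: gen => [x xA|x]; first by apply: sB; apply: sumSl.
  rewrite inE => /orP[/eqP->|/vB//]; apply: sB; apply: sumSr; exact: mem_line.
pose K := preimS (lin_of v : {linear R^o -> M}) A.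
have [a [b [_ hb _]]] : exists a b, [/\ ilen J K a, ilen K (fullS R^o) b & N = (a + b)%N].
  by apply: ilen_split => // r rJ; rewrite mem_preimS; apply: JA.
exists (b + l)%N; apply: ilen_add hl => //; first exact: sumSl.
by apply/(ilen_line (K := K)).
Qed.

End FinGenLength.

(** * Noetherian local rings *)

Section IdealBasics.
Variable R : comNzRingType.
Implicit Types (A B C K : ideal R) (a b r x y : R).

Lemma idl0 A : (0 : R) \in A. Proof. exact: (@rpred0 R^o). Qed.
Lemma idlD A x y : x \in A -> y \in A -> x + y \in A.
Proof. exact: (@rpredD R^o). Qed.
Lemma idlMl A a x : x \in A -> a * x \in A.
Proof. exact: (@rpredZ R R^o). Qed.
Lemma idlMr A a x : x \in A -> x * a \in A.
Proof. by rewrite mulrC; apply: idlMl. Qed.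
Lemma idlN A x : x \in A -> - x \in A.
Proof. exact: (@rpredNZ R R^o). Qed.
Lemma idlB A x y : x \in A -> y \in A -> x - y \in A.
Proof. by move=> xA yA; apply: idlD => //; apply: idlN. Qed.
Lemma idl_sum A (I : Type) (s : seq I) (P : pred I) (F : I -> R) :
  (forall i, P i -> F i \in A) -> \sum_(i <- s | P i) F i \in A.
Proof. exact: (@rpred_sum R^o). Qed.

Lemma colonP A B x : reflect (forall b, b \in B -> x * b \in A) (x \in colon A B).
Proof. exact: asboolP. Qed.

Lemma mul_idl A B a b : a \in A -> b \in B -> a * b \in ideal_mul A B.
Proof. by move=> aA bB; apply: mem_spanS; exists a, b. Qed.

Lemma mul_idl_sub A B C : (forall a b, a \in A -> b \in B -> a * b \in C) ->
  {subset ideal_mul A B <= C}.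
Proof. by move=> h; apply: spanS_sub => _ [a [b [aA bB ->]]]; apply: h. Qed.

Lemma mul_idl_subl A B : {subset ideal_mul A B <= A}.
Proof. by apply: mul_idl_sub => a b aA _; apply: idlMr. Qed.

Lemma mul_idl_subr A B : {subset ideal_mul A B <= B}.
Proof. by apply: mul_idl_sub => a b _; apply: idlMl. Qed.

Lemma exp_idl_sub A i j : (i <= j)%N -> {subset ideal_exp A j <= ideal_exp A i}.
Proof.
move/subnKC <-; elim: (j - i)%N => [|q IH] x; first by rewrite addn0.
by rewrite addnS => h; apply: IH; apply: mul_idl_subr h.
Qed.

Lemma mem_ideal_gen (s : seq R) x :
  x \in ideal_gen s <-> exists c : nat -> R, x = \sum_(i < size s) c i * s`_i.
Proof.
pose P x := `[< exists c : nat -> R, x = \sum_(i < size s) c i * s`_i >].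
have cl : @submod_closed R R^o P.
  split; first by apply/asboolP; exists (fun _ => 0); rewrite big1 // => i _; rewrite mul0r.
  move=> r u v /asboolP[c ->] /asboolP[e ->]; apply/asboolP.
  exists (fun i => r * c i + e i); rewrite [_ *: _]mulr_sumr -big_split /=.
  by apply: eq_bigr => i _; rewrite mulrDl mulrA.
split.
  move/(spanS_sub (A := mk_submod cl)) => h; apply/asboolP; apply: h => y ys.
  apply/asboolP; exists (fun i => (i == index y s)%:R).
  have hi : (index y s < size s)%N by rewrite index_mem.
  rewrite (bigD1 (Ordinal hi)) //= eqxx mul1r nth_index // big1 ?addr0 // => i.
  by rewrite -val_eqE /= => /negbTE->; rewrite mul0r.
move=> [c ->]; apply: idl_sum => i _; apply: idlMl; apply: mem_spanS.
exact: mem_nth.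
Qed.

Lemma mem_gen (s : seq R) x : x \in s -> x \in ideal_gen s.
Proof. exact: mem_spanS. Qed.

Lemma gen_sub (s : seq R) A : (forall x, x \in s -> x \in A) -> {subset ideal_gen s <= A}.
Proof. exact: (@spanS_sub R R^o (fun x => x \in s)). Qed.

Lemma sumlP A x y :
  y \in sumS A (line (x : R^o)) <-> exists r, y - r * x \in A.
Proof.
split=> [/sumSP[a aA /lineP[r er]]|[r h]].
  by exists r; rewrite -[r * x]er subKr.
apply/sumSP; exists (y - r * x) => //; rewrite subKr.
by apply/lineP; exists r.
Qed.

Lemma strict_line A x : x \notin A -> strict_sub A (sumS A (line (x : R^o))).
Proof.
move=> xA; split; first exact: sumSl.
by move=> h; case/negP: xA; apply: h; apply: sumSr; apply: mem_line.
Qed.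

(** If [P] failed somewhere, choice would give an infinite strictly increasing chain of ideals; its
    union is finitely generated, hence reached at a finite stage. *)
Lemma noeth_ind (P : ideal R -> Prop) : noetherian R ->
  (forall A, (forall B, strict_sub A B -> P B) -> P A) -> forall A, P A.
Proof.
move=> noe step A0; apply: contrapT => nA0.
have next (A : {A | ~ P A}) : exists B : {A | ~ P A}, strict_sub (sval A) (sval B).
  apply: contrapT => h; apply: (svalP A); apply: step => B AB.
  by apply: contrapT => nB; apply: h; exists (exist _ B nB).
have [f hf] := choice next.
pose c i := sval (iter i f (exist _ A0 nA0)).
have cs i : strict_sub (c i) (c i.+1) by apply: hf.
have cle i j : (i <= j)%N -> {subset c i <= c j}.
  move/subnKC<-; elim: (j - i)%N => [|q IH] x; first by rewrite addn0.
  by rewrite addnS => /IH; case: (cs (i + q)%N) => h _ /h.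
have cl : @submod_closed R R^o (fun x => `[< exists i, x \in c i >]).
  split; first by apply/asboolP; exists 0%N; apply: idl0.
  move=> r x y /asboolP[i xi] /asboolP[j yj]; apply/asboolP; exists (i + j)%N.
  apply: idlD; last by apply: cle yj; apply: leq_addl.
  by apply: idlMl; apply: cle xi; apply: leq_addr.
have [s hs] := noe (mk_submod cl).
have [n hn] : exists n, forall x, x \in s -> x \in c n.
  have : forall x, x \in s -> exists i, x \in c i.
    by move=> x xs; apply/asboolP; rewrite -[asbool _]/(x \in mk_submod cl) hs mem_gen.
  elim: s {hs} => [|x s IH] h; first by exists 0%N.
  have [|n hn] := IH; first by move=> y ys; apply: h; rewrite inE ys orbT.
  have [|i xi] := h x; first by rewrite inE eqxx.
  exists (n + i)%N => y; rewrite inE => /orP[/eqP->|/hn].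
    by apply: cle xi; apply: leq_addl.
  by apply: cle; apply: leq_addr.
have [_] := cs n; apply=> x xn.
have : x \in mk_submod cl by apply/asboolP; exists n.+1.
by rewrite hs; apply: gen_sub.
Qed.

(** An ideal maximal among those disjoint from the multiplicative set [S] is prime: if ab is in A
    with a and b outside, and both A + Ra and A + Rb meet [S], then A contains a product of two
    elements of [S]. Noetherian induction takes the place of Zorn's lemma. *)
Lemma prime_avoid (S : R -> Prop) A : noetherian R ->
  S 1 -> (forall x y, S x -> S y -> S (x * y)) -> (forall x, x \in A -> ~ S x) ->
  exists P : ideal R, [/\ prime_ideal P, {subset A <= P} & forall x, x \in P -> ~ S x].
Proof.
move=> noe S1 SM; move: A; apply: (noeth_ind noe) => A IH hA.
have [pA|npA] := pselect (prime_ideal A); first by exists A; split.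
have [a [b [aA bA abA]]] : exists a b, [/\ a \notin A, b \notin A & a * b \in A].
  apply: contrapT => h; apply: npA; split; first by apply/negP => /hA.
  move=> a b abA; apply: contrapT => /negP; rewrite negb_or => /andP[aA bA].
  by apply: h; exists a, b.
have meet x : x \notin A -> (exists P : ideal R,
    [/\ prime_ideal P, {subset A <= P} & forall y, y \in P -> ~ S y]) \/
    exists y, S y /\ exists r, y - r * x \in A.
  move=> xA; have [h|h] := pselect (exists y, S y /\ exists r, y - r * x \in A).
    by right.
  left; have [y /sumlP yA Sy|P [P1 P2 P3]] := IH _ (strict_line xA).
    by apply: h; exists y.
  by exists P; split=> // y yA; apply: P2; apply: sumSl.
have [//|[s [Ss [r hs]]]] := meet _ aA.
have [//|[t [St [q ht]]]] := meet _ bA.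
case: (hA (s * t)); last exact: SM.
have -> : s * t = (s - r * a) * t + (r * a) * (t - q * b) + r * q * (a * b) by ring.
by apply: idlD; first apply: idlD; [apply: idlMr|apply: idlMl|apply: idlMl].
Qed.

End IdealBasics.

Section Local.
Variables (R : comNzRingType) (m : ideal R).
Hypotheses (noe : noetherian R) (loc : local_ring m).
Implicit Types (A B C K L J : ideal R).

Lemma local1 : 1 \notin m. Proof. by case: loc => -[]. Qed.

Lemma sub_local A : 1 \notin A -> {subset A <= m}.
Proof.
move: A; apply: (noeth_ind noe) => A IH A1.
have [mA|nmA] := pselect (maximal_ideal A); first by move=> x; rewrite (loc.2 _ mA).
have [B [AB B1 nBA]] : exists B, [/\ {subset A <= B}, 1 \notin B & ~ B =i A].
  apply: contrapT => h; apply: nmA; split=> // B AB B1; apply: contrapT => n.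
  by apply: h; exists B.
move=> x /AB; apply: IH => //; split=> // BA; apply: nBA => y.
by apply/idP/idP => [/BA|/AB].
Qed.

Lemma local_unit x : x \notin m -> exists y, y * x = 1.
Proof.
move=> xm; apply: contrapT => h; case/negP: xm.
apply: (@sub_local (line (x : R^o))); last exact: mem_line.
by apply/negP => /lineP[r e]; apply: h; exists r.
Qed.

Lemma local_prime : prime_ideal m.
Proof.
split=> [|x y xy]; first exact: local1.
apply: contrapT => /negP; rewrite negb_or => /andP[/local_unit[a ha] /local_unit[b hb]].
case/negP: local1; have -> : 1 = (a * b) * (x * y) by rewrite mulrACA ha hb mulr1.
exact: idlMl.
Qed.

Lemma ilen_local : ilen m (fullS R^o) 1.
Proof.
suff h n' : ichain m (fullS R^o) n' -> (n' <= 1)%N.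
  have [//|l hl l1] := @ilen_ex _ _ m (fullS R^o) 1 _ h.
  suff : (0 < l)%N by case: l hl l1 => [|[|]].
  apply: ilen_gt0 hl => // /(_ 1 isT); exact/negP/local1.
case: n' => [|[|n']] // [c [c1 c2]].
have [h1 h2] := c2 0%N isT; have [_ []] := c2 1%N isT.
have {}h2 : exists2 x, x \in c 1%N & x \notin c 0%N.
  apply: contrapT => h; apply: h2 => x x1; apply: contrapT => /negP x0.
  by apply: h; exists x.
have [x x1 x0] := h2; have [mc0 _] := c1 0%N isT.
have /local_unit[y yx] : x \notin m by apply: contra x0; apply: mc0.
move=> t _; rewrite -(mulr1 t) -yx; apply: idlMl; exact: idlMl.
Qed.

Variable J : ideal R.
Hypothesis hJ : forall P : ideal R, prime_ideal P -> {subset J <= P} -> P =i m.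

(** An associated-prime argument: for x in L outside K with K : x as large as possible, this
    annihilator is prime and contains J, hence is m. *)
Lemma socle_ex K L : {subset J <= K} -> ~ {subset L <= K} ->
  exists x, [/\ x \in L, x \notin K & forall r, r \in m -> r * x \in K].
Proof.
move=> JK nLK.
have [x0 x0L x0K] : exists2 x, x \in L & x \notin K.
  by apply: contrapT => h; apply: nLK => x xL; apply: contrapT => /negP xK; apply: h; exists x.
pose Q x := preimS (lin_of (x : R^o) : {linear R^o -> R^o}) K.
have eQ (y r : R) : (r \in Q y) = (r * y \in K) by [].
suff h A : forall x, x \in L -> x \notin K -> A =i Q x ->
    exists x, [/\ x \in L, x \notin K & forall r, r \in m -> r * x \in K].
  by apply: (h (Q x0) x0).
move: A; apply: (noeth_ind noe) => A IH x xL xK eA.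
have [pA|nA] := pselect (prime_ideal (Q x)).
  exists x; split=> // r; rewrite -(hJ pA) // => y yJ.
  by rewrite eQ; apply: idlMr; apply: JK.
have [a [b [aA bA abA]]] : exists a b, [/\ a \notin Q x, b \notin Q x & a * b \in Q x].
  apply: contrapT => h; apply: nA; split.
    by rewrite eQ mul1r.
  move=> a b abA; apply: contrapT => /negP; rewrite negb_or => /andP[aA bA].
  by apply: h; exists a, b.
(* The element [b * x] is still outside [K], and its annihilator gains [a]. *)
apply: (IH (Q (b * x)) _ (b * x)) => //; last by apply: idlMl.
split=> [r|].
  by rewrite eA !eQ => h; rewrite mulrCA; apply: idlMl.
move=> h; case/negP: aA; rewrite -eA; apply: h; rewrite eQ mulrA.
by move: abA; rewrite eQ.
Qed.

Lemma ilen_socle K x : x \notin K -> (forall r, r \in m -> r * x \in K) ->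
  ilen K (sumS K (line (x : R^o))) 1.
Proof.
move=> xK mx; apply/(ilen_line (K := m)); last exact: ilen_local.
move=> r; apply/idP/idP => [h|/mx//].
apply: contrapT => /negP/local_unit[y yr]; case/negP: xK.
rewrite -(mul1r x) -yr -mulrA; exact: idlMl.
Qed.

Lemma ilen_artin K : {subset J <= K} -> exists l, ilen K (fullS R^o) l.
Proof.
move: K; apply: (noeth_ind noe) => K IH JK.
have [h|h] := pselect {subset fullS R^o <= K}; first by exists 0%N; apply: ilen0.
have [x [_ xK mx]] := socle_ex JK h.
have [|l hl] := IH _ (strict_line xK).
  by move=> y /JK; apply: sumSl.
exists (1 + l)%N; apply: ilen_add hl => //; first exact: sumSl.
exact: ilen_socle.
Qed.

End Local.

(** * Regular sequences *)

Section RegularSeq.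
Variables (R : comNzRingType) (z : seq R).
Hypothesis zreg : forall i (x : R), (i < size z)%N ->
  x * z`_i \in ideal_gen (take i z) -> x \in ideal_gen (take i z).

Lemma mem_gen_take i (x : R) : (i <= size z)%N ->
  x \in ideal_gen (take i z) <-> exists c : nat -> R, x = \sum_(j < i) c j * z`_j.
Proof.
move=> iz; rewrite mem_ideal_gen size_takel //.
by split=> -[c ->]; exists c; apply: eq_bigr => j _; rewrite nth_take.
Qed.

(* Exactness of the Koszul complex of a regular sequence in degree 1. *)
Lemma regular_syzygy i (u : nat -> R) : (i <= size z)%N ->
  \sum_(j < i) u j * z`_j = 0 ->
  exists c : nat -> nat -> R, [/\ forall a, c a a = 0, forall a b, c a b = - c b a
    & forall j, (j < i)%N -> u j = \sum_(l < i) c j l * z`_l].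
Proof.
elim: i u => [|i IH] u iz.
  by move=> _; exists (fun _ _ => 0); split=> // a b; rewrite oppr0.
rewrite big_ord_recr /= => hu.
(* Regularity puts the last coefficient in the ideal of the earlier z_j, say u_i = sum b_j z_j;
   substituting leaves a shorter relation with coefficients u_j + b_j z_i. *)
have /zreg : u i * z`_i \in ideal_gen (take i z).
  apply/mem_gen_take; first exact: ltnW.
  exists (fun j => - u j); apply/eqP.
  under eq_bigr do rewrite mulNr.
  by rewrite sumrN -addr_eq0 addrC hu.
move=> /(_ iz)/mem_gen_take[|b hb]; first exact: ltnW.
have [|c [c0 cN hc]] := IH (fun j => u j + b j * z`_i) (ltnW iz).
  rewrite -[RHS]hu hb mulr_suml -big_split /=; apply: eq_bigr => j _.
  by rewrite mulrDl mulrAC.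
(* The new row and column hold [b] and its negative, which cancels the correction b_j z_i. *)
exists (fun j l => if j == i then (if l == i then 0 else b l)
                   else if l == i then - b j else c j l); split.
- by move=> a; case: eqP.
- move=> a e; case: (a == i); case: (e == i); rewrite ?oppr0 ?opprK //; exact: cN.
- move=> j; rewrite ltnS leq_eqVlt => /orP[/eqP->|ji].
    rewrite big_ord_recr /= !eqxx mul0r addr0 hb; apply: eq_bigr => l _.
    by rewrite ltn_eqF.
  rewrite big_ord_recr /= eqxx (ltn_eqF ji) mulNr.
  apply/eqP; rewrite -subr_eq opprK; apply/eqP; rewrite (hc _ ji); apply: eq_bigr => l _.
  by rewrite ltn_eqF.
Qed.

Variables (m : ideal R) (d : nat).
Hypotheses (noe : noetherian R) (loc : local_ring m) (kd : krull_dim R d) (sz : size z = d).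

(** As z_i is regular modulo its predecessors, a prime P containing z_0, ..., z_i cannot be minimal
    over z_0, ..., z_(i-1): some prime below P omits z_i. *)
Lemma regular_prime_chain i (P : ideal R) : (i <= size z)%N ->
  prime_ideal P -> {subset ideal_gen (take i z) <= P} ->
  exists p : nat -> ideal R, [/\ forall j, (j <= i)%N -> prime_ideal (p j),
    forall j, (j < i)%N -> strict_sub (p j) (p j.+1) & p i = P].
Proof.
elim: i P => [|i IH] P iz pP sP; first by exists (fun _ => P).
have ziP : z`_i \in P.
  apply: sP; apply/mem_gen_take => //; exists (fun j => (j == i)%:R).
  rewrite big_ord_recr /= eqxx mul1r big1 ?add0r // => j _.
  by rewrite ltn_eqF // mul0r.
(* Avoiding the products of powers of z_i with elements outside [P] forces both Q <= P and z_i
   outside Q. *)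
pose S x := exists y n, y \notin P /\ x = y * z`_i ^+ n.
have P1 : 1 \notin P by case: pP.
have [||x xt [y [n [yP ex]]]|Q [pQ sQ hQ]] := @prime_avoid _ S (ideal_gen (take i z)) noe.
- by exists 1, 0%N; rewrite mulr1.
- move=> _ _ [y [n [yP ->]]] [y' [n' [yP' ->]]]; exists (y * y'), (n + n')%N.
  split; last by rewrite exprD mulrACA.
  apply/negP => /(proj2 pP); by rewrite (negbTE yP) (negbTE yP').
- case/negP: yP; apply: sP; move: xt; rewrite {}ex.
  have sub1 : {subset ideal_gen (take i z) <= ideal_gen (take i.+1 z)}.
    apply: gen_sub => t tz; apply: mem_gen.
    by rewrite (take_nth 0) // mem_rcons inE tz orbT.
  elim: n => [|n IHn]; first by rewrite mulr1; apply: sub1.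
  by rewrite exprSr mulrA => /zreg-/(_ iz).
have QP : {subset Q <= P}.
  move=> x xQ; apply: contrapT => /negP xP; apply: (hQ _ xQ).
  by exists x, 0%N; rewrite mulr1.
have ziQ : z`_i \notin Q.
  by apply/negP => /hQ; apply; exists 1, 1%N; rewrite mul1r.
have [p [p1 p2 p3]] := IH Q (ltnW iz) pQ sQ.
exists (fun j => if (j <= i)%N then p j else P); split.
- by move=> j _; case: ifP => // /p1.
- move=> j; rewrite ltnS leq_eqVlt => /orP[/eqP->|ji].
    rewrite eqxx ltnn p3; split=> // PQ.
    by case/negP: ziQ; apply: PQ.
  by rewrite ji orbT; apply: p2.
- by rewrite ltnn.
Qed.

Lemma regular_primes (P : ideal R) : prime_ideal P -> {subset ideal_gen z <= P} -> P =i m.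
Proof.
move=> pP sP; apply: contrapT => nPm.
have Pm : {subset P <= m} by apply: (sub_local noe loc); case: pP.
have [|p [p1 p2 p3]] := regular_prime_chain (leqnn _) pP.
  by rewrite take_size.
(* The chain of length d ending at P could be extended by m, against dim R = d. *)
have [_ /(_ d.+1)] := kd; rewrite ltnn -sz => h; suff /h : prime_chain R (size z).+1 by [].
exists (fun j => if (j <= size z)%N then p j else m); split=> j.
  by move=> _; case: ifP => [/p1//|_]; apply: local_prime.
rewrite ltnS leq_eqVlt => /orP[/eqP->|ji].
  rewrite eqxx ltnn p3; split=> // mP; apply: nPm => x.
  by apply/idP/idP => [/Pm|/mP].
by rewrite ji orbT; apply: p2.
Qed.

End RegularSeq.

(** * Rings of finite injective dimension modulo a regular sequence *)

Lemma quot_lift (R : comNzRingType) (M N : lmodType R) (A : submodClosed M)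
    (f : {linear M -> N}) : (forall x, x \in A -> f x = 0) ->
  exists g : {linear quot_mod A -> N}, forall x, g (quot_proj A x) = f x.
Proof.
move=> fA; pose g (x : quot_mod A) := f (repr x).
have gE x : g (quot_proj A x) = f x.
  apply/eqP; rewrite -subr_eq0 -linearB; apply/eqP/fA/quot_proj_eq.
  exact: quot_proj_repr.
have gl : linear g.
  move=> a x y; rewrite -[x]quot_proj_repr -[y]quot_proj_repr.
  rewrite -(linearP (quot_proj A : {linear _ -> _})).
  by rewrite !gE linearP.
pose gL : {linear quot_mod A -> N} := HB.pack g (GRing.isLinear.Build _ _ _ _ g gl).
by exists gL.
Qed.

Section Killed.
Variables (R : comNzRingType) (E : lmodType R).
Implicit Types (K : ideal R) (h : E).

Definition killed K h := forall r : R, r \in K -> r *: h = 0.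

Lemma killed0 K : killed K 0. Proof. by move=> r _; rewrite scaler0. Qed.
Lemma killedB K h h' : killed K h -> killed K h' -> killed K (h - h').
Proof. by move=> k k' r rK; rewrite scalerBr k // k' // subrr. Qed.
Lemma killedD K h h' : killed K h -> killed K h' -> killed K (h + h').
Proof. by move=> k k' r rK; rewrite scalerDr k // k' // addr0. Qed.
Lemma killedZ K a h : killed K h -> killed K (a *: h).
Proof. by move=> k r rK; rewrite scalerA mulrC -scalerA k // scaler0. Qed.

(** [K'] is K + Rx, described by its elements so that both [sumS K (line x)] and
    [ideal_gen (take j.+1 z)] are instances. *)
Lemma killed_line K K' x h : (forall y : R, y \in K' <-> exists r, y - r * x \in K) ->
  killed K' h <-> killed K h /\ x *: h = 0.
Proof.
move=> hK'; split=> [k|[k kx] y /hK'[r hr]].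
  split=> [r rK|].
    by apply: k; apply/hK'; exists 0; rewrite mul0r subr0.
  by apply: k; apply/hK'; exists 1; rewrite mul1r subrr idl0.
by rewrite -(subrK (r * x) y) scalerDl k // -scalerA kx scaler0 addr0.
Qed.

(** Multiplication by x embeds R / (K : x) in R / K. The condition on [w] makes 1 |-> w a map from R
    / (K : x) to [E], and [h] is the value at 1 of an extension to R / K. *)
Lemma inj_ext K (x : R) (w : E) : injective_module E ->
  (forall r, r * x \in K -> r *: w = 0) -> exists2 h, killed K h & x *: h = w.
Proof.
move=> injE hw.
pose A := preimS (lin_of (x : R^o) : {linear R^o -> R^o}) K.
pose qx : {linear R^o -> quot_mod K} := quot_proj K \o (lin_of (x : R^o)).
have qxE (a : R) : qx a = quot_proj K (a * x : R^o) by [].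
have [i hi] : exists i : {linear quot_mod A -> quot_mod K},
    forall a, i (quot_proj A a) = qx a.
  apply: quot_lift => a; rewrite mem_preimS => aK.
  by apply/eqP; rewrite qxE quot_proj0.
have [f hf] : exists f : {linear quot_mod A -> E},
    forall a, f (quot_proj A a) = (lin_of w : {linear R^o -> E}) a.
  by apply: quot_lift => a; rewrite mem_preimS => /hw.
have [|g hg] := injE _ _ i f.
  move=> a b /eqP; rewrite -subr_eq0 -linearB -[a - b]quot_proj_repr hi qxE quot_proj0 => h.
  apply/eqP; rewrite -subr_eq0 -[a - b]quot_proj_repr quot_proj0.
  by rewrite mem_preimS.
have qZ (a : R) : a *: g (quot_proj K 1) = g (quot_proj K (a : R^o)).
  by rewrite -linearZ /= -quot_proj_scale [_ *: _]mulr1.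
exists (g (quot_proj K 1)) => [r rK|]; rewrite qZ.
  have -> : quot_proj K (r : R^o) = 0 by apply/eqP; rewrite quot_proj0.
  by rewrite linear0.
have -> : quot_proj K (x : R^o) = i (quot_proj A 1) by rewrite hi qxE mul1r.
by rewrite hg hf [LHS]scale1r.
Qed.

End Killed.

Section InjectiveResolution.
Variables (R : comNzRingType) (E : nat -> lmodType R) (e : {linear R^o -> E 0%N}).
Variable d : forall i, {linear E i -> E i.+1}.
Hypothesis injE : forall i, injective_module (E i).
Hypothesis inje : injective e.
Hypothesis ex0 : kerS (d 0%N) =i imageS e (fullS R^o).
Hypothesis exS : forall i, kerS (d i.+1) =i imageS (d i) (fullS (E i)).
Implicit Types K : ideal R.

Lemma d_d i (h : E i) : d i.+1 (d i h) = 0.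
Proof.
apply/eqP; rewrite -[_ == 0]/(d i h \in kerS (d i.+1)) exS.
by apply/imageSP; exists h.
Qed.

(** Coboundaries of Hom(R / K, E); the complex starts in degree 0, where only 0 is one. *)
Definition bd (i : nat) K : E i -> Prop :=
  match i with
  | 0 => fun w => w = 0
  | i'.+1 => fun w => exists2 h : E i', killed K h & w = d i' h
  end.

(* With [K] acting through R / K, the elements of [E i] killed by [K] form
   Hom(R / K, E i), so [acyclic i K] says that Ext^i(R / K, R) = 0. *)
Definition acyclic i K := forall w : E i, killed K w -> d i w = 0 -> bd K w.

Lemma bd0 i K : bd K (0 : E i).
Proof. by case: i => //= i; exists 0; rewrite ?linear0 //; apply: killed0. Qed.

Lemma bd_killed i K (w : E i) : bd K w -> killed K w.
Proof.
case: i w => [|i] w /= => [->|[h hK ->]]; first exact: killed0.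
by move=> r rK; rewrite -linearZ hK //= linear0.
Qed.

Lemma bd_cocycle i K (w : E i) : bd K w -> d i w = 0.
Proof. by case: i w => [|i] w /= => [->|[h _ ->]]; rewrite ?linear0 ?d_d. Qed.

Lemma bdZ i K a (w : E i) : bd K w -> bd K (a *: w).
Proof.
case: i w => [|i] w /= => [->|[h hK ->]]; first by rewrite scaler0.
by exists (a *: h); rewrite ?linearZ //; apply: killedZ.
Qed.

(** Multiplication by x is injective on R / K, hence surjective on Hom(R / K, E i) because [E i] is
    injective. *)
Lemma bd_divide i K x (w : E i) : (forall r : R, r * x \in K -> r \in K) ->
  bd K w -> exists2 w' : E i, bd K w' & w = x *: w'.
Proof.
move=> xreg; case: i w => [|i] w /=; first by move=> ->; exists 0; rewrite ?scaler0.
move=> [h hK ->]; have [|h' hK' hx] := inj_ext (K := K) (x := x) (w := h) (@injE i).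
  by move=> r /xreg/hK.
by exists (d i h'); [exists h'|rewrite -linearZ /= hx].
Qed.

Section RegularStep.
Variables (K K' : ideal R) (x : R) (j : nat).
Hypothesis xreg : forall r : R, r * x \in K -> r \in K.
Hypothesis hK' : forall y : R, y \in K' <-> exists r, y - r * x \in K.

(** The long exact sequence of 0 -> R/K -> R/K -> R/K' -> 0, whose first map is multiplication by x,
    done as a chase: a primitive h of w satisfies d (x h) = 0, so x h = x b with b a coboundary, and
    h - b is a primitive of w killed by K'. *)
Lemma acyclic_step : (forall i, (j < i)%N -> acyclic i K) ->
  forall i, (j.+1 < i)%N -> acyclic i K'.
Proof.
move=> ac [|[|i]] // ji w /(killed_line _ hK')[wK xw] dw.
have [h hK wE] := ac _ (ltnW ji) _ wK dw.
have [|b bK xh] := bd_divide (w := x *: h) xreg.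
  by apply: ac => //; [exact: killedZ|rewrite linearZ /= -wE].
exists (h - b); last by rewrite linearB /= (bd_cocycle bK) subr0.
apply/(killed_line _ hK'); rewrite scalerBr -xh subrr; split=> //.
by apply: killedB => //; apply: bd_killed bK.
Qed.

(* The connecting homomorphism carries a generator of Ext^j(R/K, R) = R/K to
   a generator of Ext^(j+1)(R/K', R) = R/K'. *)
Lemma generator_step : (forall i, (j < i)%N -> acyclic i K) ->
  (exists w : E j, [/\ killed K w, d j w = 0,
     forall c : E j, killed K c -> d j c = 0 -> exists r, bd K (c - r *: w)
   & forall r, bd K (r *: w) -> r \in K]) ->
  exists w : E j.+1, [/\ killed K' w, d j.+1 w = 0,
     forall c : E j.+1, killed K' c -> d j.+1 c = 0 -> exists r, bd K' (c - r *: w)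
   & forall r, bd K' (r *: w) -> r \in K'].
Proof.
move=> ac [w [wK dw wgen wfree]].
have [|u uK xu] := inj_ext (K := K) (x := x) (w := w) (@injE j).
  by move=> r /xreg/wK.
have duK' : killed K' (d j u).
  apply/(killed_line _ hK'); split; last by rewrite -linearZ /= xu.
  by move=> r rK; rewrite -linearZ uK //= linear0.
exists (d j u); split=> //; first exact: d_d.
- move=> c /(killed_line _ hK')[cK xc] dc.
  have [h hK cE] := ac _ (leqnn _) _ cK dc.
  have [||r hr] := wgen (x *: h); [exact: killedZ|by rewrite linearZ /= -cE|].
  have [b bK hb] := bd_divide xreg hr.
  exists r; exists (h - r *: u - b); last first.
    rewrite [RHS]linearB /= (bd_cocycle bK) subr0.
    by rewrite [RHS]linearB [X in _ = _ - X]linearZ /= -cE.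
  apply/(killed_line _ hK'); split.
    apply: killedB; last exact: bd_killed bK.
    by apply: killedB => //; apply: killedZ.
  by rewrite !scalerBr -hb scalerA mulrC -scalerA xu subrr.
- move=> r [h /(killed_line _ hK')[hK xh] rE].
  (* Both r u and h have the same differential, so r u - h is congruent to some r' w. Multiplying by
     x kills h and turns u into w, leaving (r - r' x) w. *)
  have [||r' hr'] := wgen (r *: u - h).
  + by apply: killedB => //; apply: killedZ.
  + by rewrite linearB /= -rE linearZ subrr.
  apply/hK'; exists r'; apply: wfree.
  have := bdZ x hr'; rewrite !scalerBr xh subr0 scalerA mulrC -scalerA xu.
  by rewrite scalerA (mulrC x) -scalerBl.
Qed.

End RegularStep.

Section RegularSequence.
Variable z : seq R.
Hypothesis zreg : forall i (x : R), (i < size z)%N ->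
  x * z`_i \in ideal_gen (take i z) -> x \in ideal_gen (take i z).

(** With K = (z_0, ..., z_(j-1)), the conditions on w say that r |-> r w induces an isomorphism from
    R / K to Ext^j(R / K, R). For j = 0 the complex is the resolution itself and w is the image of
    1. *)
Lemma regular_ext j : (j <= size z)%N ->
  (forall i, (j < i)%N -> acyclic i (ideal_gen (take j z))) /\
  exists w : E j, [/\ killed (ideal_gen (take j z)) w, d j w = 0,
     forall c : E j, killed (ideal_gen (take j z)) c -> d j c = 0 ->
       exists r, bd (ideal_gen (take j z)) (c - r *: w)
   & forall r, bd (ideal_gen (take j z)) (r *: w) -> r \in ideal_gen (take j z)].
Proof.
elim: j => [|j IH] jz.
  have k0 i (h : E i) : killed (ideal_gen (take 0 z)) h.
    by move=> r /mem_ideal_gen[c ->]; rewrite take0 big_ord0 scale0r.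
  split.
    move=> [|i] // _ w _ dw; have : w \in kerS (d i.+1) by rewrite mem_kerS dw.
    by rewrite exS => /imageSP[h _ ->]; exists h.
  exists (e 1); split=> //.
  - apply/eqP; rewrite -[_ == 0]/(_ \in kerS (d 0%N)) ex0.
    by apply/imageSP; exists 1.
  - move=> c _ dc; have : c \in kerS (d 0%N) by rewrite mem_kerS dc.
    rewrite ex0 => /imageSP[r _ ->]; exists r.
    by rewrite /= -linearZ /= [_ *: _]mulr1 subrr.
  - move=> r h; have {}h : r *: e 1 = 0 := h.
    suff -> : r = 0 by apply: idl0.
    by apply: inje; rewrite linear0 -h -linearZ [_ *: _]mulr1.
have [IH1 IH2] := IH (ltnW jz).
have hK' (y : R) : y \in ideal_gen (take j.+1 z) <->
    exists r, y - r * z`_j \in ideal_gen (take j z).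
  rewrite mem_gen_take //; split=> [[c ->]|[r /mem_gen_take[|c hc]]].
  - exists (c j); rewrite big_ord_recr /= addrK.
    by apply/mem_gen_take; [exact: ltnW|exists c].
  - exact: ltnW.
  - exists (fun i => if i == j then r else c i); rewrite big_ord_recr /= eqxx.
    rewrite -(subrK (r * z`_j) y) hc; congr (_ + _); apply: eq_bigr => i _.
    by rewrite ltn_eqF.
have xreg r : r * z`_j \in ideal_gen (take j z) -> r \in ideal_gen (take j z).
  exact: zreg.
split; first exact: (acyclic_step xreg hK' IH1).
exact: (generator_step xreg hK' IH1 IH2).
Qed.

Variables (m : ideal R) (n : nat).
Hypotheses (noe : noetherian R) (loc : local_ring m).
Hypothesis Ebound : forall i, (n < i)%N -> forall x : E i, x = 0.
Let J := ideal_gen z.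
Hypothesis Jproper : 1 \notin J.
Hypothesis hJ : forall P : ideal R, prime_ideal P -> {subset J <= P} -> P =i m.

Lemma socle_colon (K : ideal R) x : x \notin K -> forall r : R, r * x \in K -> r \in m.
Proof.
move=> xK r rx; apply: contrapT => /negP/(local_unit noe loc)[y yr].
by case/negP: xK; rewrite -(mul1r x) -yr -mulrA; apply: idlMl.
Qed.

Lemma acyclicJ i : (size z < i)%N -> acyclic i J.
Proof. by have [h _] := regular_ext (leqnn _); rewrite take_size in h; apply: h. Qed.

(* An element of the socle of R / J embeds R / m into R / J, and the higher
   Ext of R / J vanish. *)
Lemma acyclic_residue i : (size z < i)%N ->
  (forall K, {subset J <= K} -> acyclic i.+1 K) -> acyclic i m.
Proof.
case: i => [|i] // zi ac w wm dw.
have [|x [_ xJ mx]] := @socle_ex R m noe J hJ J (fullS R^o) (fun _ => id).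
  by move=> /(_ 1 isT); apply/negP.
(* [w] is a map on R / m, which x embeds in R / J, and [f] extends it. The differential of f
   vanishes on x, so it has a primitive g vanishing on x. Then f - g is a cocycle on R / J, and x
   times its primitive is a primitive of w. *)
have [|f fJ xf] := inj_ext (K := J) (x := x) (w := w) (@injE i.+1).
  by move=> r /(socle_colon xJ)/wm.
have hL := sumlP J x.
have [|||g /(killed_line _ hL)[gJ xg] dfg] := ac (sumS J (line (x : R^o))) _ (d _ f).
- exact: sumSl.
- apply/(killed_line _ hL); split; last by rewrite -linearZ /= xf.
  by move=> r rJ; rewrite -linearZ fJ //= linear0.
- exact: d_d.
have [||h hhJ fg] := acyclicJ zi (w := f - g).
- exact: killedB.
- by rewrite linearB /= dfg subrr.
exists (x *: h) => [r rm|].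
  by rewrite scalerA; apply: hhJ; apply: mx.
by rewrite linearZ /= -fg scalerBr xg subr0.
Qed.

(** [q] measures the descent on the degree. For fixed i, Noetherian induction on K uses 0 -> R/m ->
    R/K -> R/(K + Rx) -> 0 with x a socle element; the case of R/m comes from degree i + 1. *)
Lemma acyclic_dim q i K : (size z < i)%N -> (n < i + q)%N -> {subset J <= K} -> acyclic i K.
Proof.
elim: q i K => [|q IH] i K zi niq.
  move=> _ w _ _; rewrite addn0 in niq; rewrite (Ebound niq w); exact: bd0.
move: K; apply: (noeth_ind noe) => K IHK JK w wK dw.
have acm : acyclic i m.
  by apply: acyclic_residue => // L; apply: IH; [exact: ltnW|rewrite addSnnS].
have [h|h] := pselect {subset fullS R^o <= K}.
  have -> : w = 0 by rewrite -(scale1r w); apply: wK; apply: h.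
  exact: bd0.
have [x [_ xK mx]] := socle_ex noe hJ JK h.
case: i zi niq w wK dw IHK acm => [|i] // zi niq w wK dw IHK acm.
(* The restriction x w of w to R / m has a primitive g. Once g is extended to g' on R / K, the
   cocycle w - d g' vanishes on x, so the induction on K applies to it. *)
have [||g gm xw] := acm (x *: w).
- by move=> r rm; rewrite scalerA; apply: wK; apply: mx.
- by rewrite linearZ /= dw scaler0.
have [|g' gK xg'] := inj_ext (K := K) (x := x) (w := g) (@injE i).
  by move=> r /(socle_colon xK)/gm.
have hL := sumlP K x.
have [|||f /(killed_line _ hL)[fK _] fE] := IHK _ (strict_line xK) _ (w - d _ g').
- by move=> y /JK; apply: sumSl.
- apply/(killed_line _ hL); split; last by rewrite scalerBr -linearZ /= xg' xw subrr.
  by apply: killedB => // r rK; rewrite -linearZ gK //= linear0.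
- by rewrite linearB /= dw d_d subrr.
exists (f + g'); first exact: killedD.
by rewrite linearD /= -fE subrK.
Qed.

Lemma socle_dim1 (x y : R) : x \notin J ->
  (forall r, r \in m -> r * x \in J) -> (forall r, r \in m -> r * y \in J) ->
  exists r, y - r * x \in J.
Proof.
move=> xJ mx my.
have [_ [w [wJ dw wgen wfree]]] := regular_ext (leqnn _).
rewrite take_size -/J in wJ wgen wfree.
(* The map x |-> y w is defined since m kills y modulo J, and [f] extends it. Correcting f by a
   suitable g vanishing on x gives a cocycle, congruent to some r w; multiplying by x makes (y - r
   x) w a coboundary. *)
have [|f fJ xf] := inj_ext (K := J) (x := x) (w := y *: w) (@injE (size z)).
  by move=> r /(socle_colon xJ) rm; rewrite scalerA; apply: wJ; apply: my.
have hL := sumlP J x.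
have [|||||g /(killed_line _ hL)[gJ xg] dfg] :=
    @acyclic_dim n (size z).+1 (sumS J (line (x : R^o))) _ _ _ (d _ f).
- exact: ltnSn.
- by rewrite addSn ltnS leq_addl.
- exact: sumSl.
- apply/(killed_line _ hL); split; last by rewrite -linearZ /= xf linearZ /= dw scaler0.
  by move=> r rJ; rewrite -linearZ fJ //= linear0.
- exact: d_d.
have [||r hr] := wgen (f - g).
- exact: killedB.
- by rewrite linearB /= dfg subrr.
exists r; apply: wfree; have := bdZ x hr.
by rewrite !scalerBr xf xg subr0 scalerA -scalerBl (mulrC x).
Qed.

End RegularSequence.

End InjectiveResolution.

Lemma gorenstein_type1 (R : comNzRingType) (m : ideal R) (z : seq R) (d : nat) :
  gorenstein_local m -> krull_dim R d -> regular_sequence z -> size z = d ->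
  ilen (ideal_gen z) (colon (ideal_gen z) m) 1.
Proof.
move=> [noe loc [n [E [e [D [injE bnd inje ex0 exS]]]]]] kd [zreg J1] sz.
have hJ := regular_primes zreg noe loc kd sz.
have [|x [_ xJ mx]] := @socle_ex R m noe _ hJ (ideal_gen z) (fullS R^o) (fun _ => id).
  by move=> /(_ 1 isT); apply/negP.
apply: ilen_eq (ilen_socle noe loc xJ mx) => //; last exact: sumSl.
move=> y; apply/idP/colonP => [/sumlP[r h] b bm|h].
  rewrite -(subrK (r * x) y) mulrDl; apply: idlD; first exact: idlMr.
  by rewrite mulrC mulrCA; apply: idlMl; apply: mx.
apply/sumlP; apply: (socle_dim1 injE inje ex0 exS zreg noe loc bnd J1 hJ xJ mx).
by move=> r rm; rewrite mulrC; apply: h.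
Qed.

(** * Minimal generators and linkage *)

Lemma mem_preim_mul (R : comNzRingType) (K : ideal R) (r x : R) :
  (x \in preimS (lin_of (r : R^o) : {linear R^o -> R^o}) K) = (x * r \in K).
Proof. by []. Qed.

Section MinimalGenerators.
Variables (R : comNzRingType) (m : ideal R).
Hypotheses (noe : noetherian R) (loc : local_ring m).

Lemma mem_remove_nth (w : seq R) i j : (j < size w)%N -> j != i ->
  w`_j \in take i w ++ drop i.+1 w.
Proof.
move=> jw; rewrite neq_ltn mem_cat => /orP[ji|ij].
  by rewrite -(nth_take 0 ji) mem_nth // size_take_min leq_min ji.
rewrite -(subnKC ij) -nth_drop mem_nth ?orbT // size_drop.
by rewrite ltn_sub2r // (leq_ltn_trans ij jw).
Qed.

Lemma gen_remove_nth (w : seq R) i :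
  {subset ideal_gen w <=
     sumS (ideal_gen (take i w ++ drop i.+1 w)) (line (w`_i : R^o))}.
Proof.
apply: gen_sub => x xw; have hx := nth_index 0 xw.
have [e|ne] := eqVneq (index x w) i.
  by rewrite -hx e; apply: sumSr; apply: mem_line.
by rewrite -hx; apply: sumSl; apply: mem_gen; apply: mem_remove_nth; rewrite ?index_mem.
Qed.

Section Independence.
Variables (I : ideal R) (u v : seq R).
Hypothesis minI : minimal_generators (u ++ v) I.

Lemma minimal_independent (c : 'I_(size v) -> R) :
  \sum_t c t *: (v`_t : R^o) \in sumS (ideal_gen u) (ideal_mul m I) ->
  forall t, c t \in m.
Proof.
have [eI minI0] := minI; set w := u ++ v in eI minI0.
move=> hc t; apply: contrapT => /negP ct.
pose i := (size u + t)%N.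
have wi : w`_i = v`_t by rewrite nth_cat ltnNge leq_addr /= addKn.
have iw : (i < size w)%N by rewrite size_cat ltn_add2l.
pose S := ideal_gen (take i w ++ drop i.+1 w).
have wS := @gen_remove_nth w i; rewrite -/S wi in wS.
have jS j : (j < size w)%N -> j != i -> w`_j \in S.
  by move=> jw ji; apply: mem_gen; apply: mem_remove_nth.
have uS : {subset ideal_gen u <= S}.
  apply: gen_sub => x xu; have xi : (index x u < size u)%N by rewrite index_mem.
  have -> : x = w`_(index x u) by rewrite nth_cat xi nth_index.
  apply: jS; first by rewrite size_cat ltn_addr.
  by rewrite ltn_eqF // ltn_addr.
pose C := sumS S (imageS (lin_of (v`_t : R^o) : {linear R^o -> R^o}) m).
have mIC : {subset ideal_mul m I <= C}.
  apply: mul_idl_sub => a b am; rewrite eI => /wS/sumlP[r hr].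
  apply/sumSP; exists (a * (b - r * v`_t)); first exact: idlMl.
  apply/imageSP; exists (a * r); first exact: idlMr.
  by have -> : a * b - a * (b - r * v`_t) = a * r * v`_t by ring.
have : c t * v`_t \in C.
  have -> : c t * v`_t = \sum_t0 c t0 *: (v`_t0 : R^o) - \sum_(j | j != t) c j * v`_j.
    by rewrite (bigD1 t) //= addrK.
  apply: idlB.
    move: hc => /sumSP[a /uS aS /mIC xC]; rewrite -(subrK a (\sum_t0 _)).
    by apply: idlD => //; apply: sumSl.
  apply: sumSl; apply: idl_sum => j jt; apply: idlMl.
  have -> : v`_j = w`_(size u + j) by rewrite nth_cat ltnNge leq_addr /= addKn.
  by apply: jS; rewrite ?size_cat ?ltn_add2l // eqn_add2l.
move=> /sumSP[a aS /imageSP[r rm er]].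
have vS : v`_t \in S.
  have : c t - r \notin m.
    by apply: contra ct => h; rewrite -(subrK r (c t)); apply: idlD.
  move=> /(local_unit noe loc)[y hy].
  rewrite -(mul1r v`_t) -hy -mulrA; apply: idlMl.
  suff -> : (c t - r) * v`_t = a by [].
  have {}er : c t * v`_t - a = r * v`_t := er.
  by rewrite mulrBl -er; ring.
apply: (minI0 i iw) => x; rewrite eI; apply/idP/idP; last first.
  by apply: gen_sub => y; rewrite mem_cat => /orP[/mem_take|/mem_drop]; apply: mem_gen.
move/wS/sumlP=> [q hq]; rewrite -(subrK (q * v`_t) x); apply: idlD => //.
exact: idlMl.
Qed.

(** Taken with [u] the regular sequence to count the remaining generators of I, and with [u] empty
    to compare two minimal generating sets. *)
Lemma ilen_minimal_generators : ilen (sumS (ideal_gen u) (ideal_mul m I)) I (size v).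
Proof.
have [eI _] := minI; set w := u ++ v in eI.
have uI : {subset ideal_gen u <= I}.
  by apply: gen_sub => x xu; rewrite eI; apply: mem_gen; rewrite mem_cat xu.
have vI t : (t < size v)%N -> v`_t \in I.
  by move=> tv; rewrite eI; apply: mem_gen; rewrite mem_cat mem_nth ?orbT.
have AI : {subset sumS (ideal_gen u) (ideal_mul m I) <= I}.
  move=> x /sumSP[a /uI aI xa]; rewrite -(subrK a x); apply: idlD => //.
  exact: mul_idl_subr xa.
have -> : size v = (#|'I_(size v)| * 1)%N by rewrite card_ord muln1.
apply: (@ilen_free _ _ _ (fun t : 'I_(size v) => v`_t : R^o) _ _ m).
- exact: ilen_local.
- exact: AI.
- by move=> t; apply: vI.
- move=> x; rewrite eI => /mem_ideal_gen[c ->].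
  exists (fun t : 'I_(size v) => c (size u + t)%N).
  have -> : \sum_(i < size w) c i * w`_i = \sum_(i < size u) c i * w`_i +
      \sum_(t < size v) c (size u + t)%N *: (v`_t : R^o).
    rewrite size_cat big_split_ord /=; congr (_ + _).
    apply: eq_bigr => t _; congr (_ * _).
    by rewrite nth_cat ltnNge leq_addr /= addKn.
  rewrite addrK; apply: sumSl; apply: idl_sum => i _; apply: idlMl; apply: mem_gen.
  by rewrite nth_cat ltn_ord mem_nth.
- by move=> t r rm; apply: sumSr; apply: mul_idl => //; apply: vI.
- exact: minimal_independent.
Qed.

End Independence.

End MinimalGenerators.

(** * Coefficients with respect to a regular sequence *)

Section RegularIdeal.
Variables (R : comNzRingType) (z : seq R).
Hypothesis zreg : forall i (x : R), (i < size z)%N ->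
  x * z`_i \in ideal_gen (take i z) -> x \in ideal_gen (take i z).
Let J := ideal_gen z.

Lemma regular_coef (u : nat -> R) : \sum_(j < size z) u j * z`_j = 0 ->
  forall j, (j < size z)%N -> u j \in J.
Proof.
move=> hu j jz; have [c [_ _ hc]] := regular_syzygy zreg (leqnn _) hu.
by apply/mem_ideal_gen; exists (c j); apply: hc.
Qed.

Lemma mem_mul_gen (A : ideal R) x : x \in ideal_mul J A ->
  exists c : nat -> R, (forall j, c j \in A) /\ x = \sum_(j < size z) c j * z`_j.
Proof.
pose P x := `[< exists c : nat -> R,
  (forall j, c j \in A) /\ x = \sum_(j < size z) c j * z`_j >].
have cl : @submod_closed R R^o P.
  split.
    apply/asboolP; exists (fun _ => 0); split=> [_|]; first exact: idl0.
    by rewrite big1 // => i _; rewrite mul0r.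
  move=> r a b /asboolP[c [cA ->]] /asboolP[e [eA ->]]; apply/asboolP.
  exists (fun i => r * c i + e i); split=> [j|].
    by apply: idlD => //; apply: idlMl.
  rewrite [_ *: _]mulr_sumr -big_split /=.
  by apply: eq_bigr => i _; rewrite mulrDl mulrA.
move/(mul_idl_sub (C := mk_submod cl)) => h; apply/asboolP; apply: h => a b.
move=> /mem_ideal_gen[c ->] bA; apply/asboolP; exists (fun j => c j * b).
split=> [j|]; first exact: idlMl.
by rewrite mulr_suml; apply: eq_bigr => j _; rewrite mulrAC.
Qed.

(** Two expressions of one element in the z_j differ by a relation, whose coefficients lie in J and
    hence in A; so J / JA is free over R / A on the z_j. *)
Lemma ilen_regular (A : ideal R) l : {subset J <= A} ->
  ilen A (fullS R^o) l -> ilen (ideal_mul J A) J (size z * l).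
Proof.
move=> JA hl; rewrite -[size z]card_ord.
apply: (@ilen_free _ _ _ (fun t : 'I_(size z) => z`_t : R^o) _ _ A) => //.
- exact: mul_idl_subl.
- by move=> t; apply: mem_gen; apply: mem_nth.
- move=> x /mem_ideal_gen[c ->]; exists (fun t : 'I_(size z) => c t); rewrite subrr; exact: idl0.
- by move=> t r rA; rewrite [_ *: _]mulrC; apply: mul_idl => //; apply: mem_gen; apply: mem_nth.
- move=> c /mem_mul_gen[c' [c'A e]] t.
  pose u j := (if insub j is Some i then c i else 0) - c' j.
  have uE (j : 'I_(size z)) : u j = c j - c' j by rewrite /u valK.
  have /regular_coef/(_ t (ltn_ord t)) : \sum_(j < size z) u j * z`_j = 0.
    under eq_bigr do rewrite uE mulrBl.
    by rewrite sumrB -e subrr.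
  by rewrite uE => /JA h; rewrite -(subrK (c' t) (c t)); apply: idlD.
Qed.

End RegularIdeal.

Lemma colon_eqr (R : comNzRingType) (A B B' : ideal R) :
  B =i B' -> colon A B =i colon A B'.
Proof.
by move=> e x; apply/colonP/colonP => h b hb; apply: h; rewrite ?e // -e.
Qed.

Lemma colon_sub (R : comNzRingType) (A B B' : ideal R) :
  {subset B <= B'} -> {subset colon A B' <= colon A B}.
Proof. by move=> s x /colonP h; apply/colonP => b /s/h. Qed.

Lemma sub_colon (R : comNzRingType) (A B : ideal R) : {subset A <= colon A B}.
Proof. by move=> x xA; apply/colonP => b _; apply: idlMr. Qed.

Lemma colon_full (R : comNzRingType) (A : ideal R) : colon A (fullS R^o) =i A.
Proof.
move=> x; apply/colonP/idP => [/(_ 1 isT)|xA b _]; first by rewrite mulr1.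
exact: idlMr.
Qed.

Lemma colon_self (R : comNzRingType) (A : ideal R) : colon A A =i fullS R^o.
Proof. by move=> x; rewrite mem_fullS; apply/colonP => b; apply: idlMl. Qed.

(** * Duality modulo an ideal of type one *)

Section Duality.
Variables (R : comNzRingType) (m J : ideal R).
Hypotheses (noe : noetherian R) (loc : local_ring m).
Hypothesis hJ : forall P : ideal R, prime_ideal P -> {subset J <= P} -> P =i m.
Hypothesis type1 : ilen J (colon J m) 1.
Implicit Types K L Q : ideal R.

(** For a socle element x of L modulo K and K1 = K + Rx, multiplication by x embeds (J:K)/(J:K1) in
    (J:m)/J, which has length one. *)
Lemma colon_ilen_le q K L : {subset J <= K} -> {subset K <= L} -> ilen K L q ->
  exists2 q', ilen (colon J L) (colon J K) q' & (q' <= q)%N.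
Proof.
elim: q K => [|q IH] K JK KL hq.
  exists 0%N => //; apply: ilen0; first exact: colon_sub.
  by apply: colon_sub; apply: ilen0P hq.
have [LK|nLK] := pselect {subset L <= K}.
  by exists 0%N => //; apply: ilen0; apply: colon_sub.
have [x [xL xK mx]] := socle_ex noe hJ JK nLK.
set K1 := sumS K (line (x : R^o)).
have KK1 : {subset K <= K1} by exact: sumSl.
have K1L : {subset K1 <= L}.
  by move=> y /sumlP[r /KL h]; rewrite -(subrK (r * x) y); apply: idlD => //; apply: idlMl.
have [a [b [ha hb /eqP]]] := ilen_split KK1 K1L hq.
rewrite (ilen_inj ha (ilen_socle noe loc xK mx)) add1n eqSS => /eqP qb.
rewrite -qb in hb.
have [|q' hq' q'q] := IH K1 _ K1L hb; first by move=> y /JK/KK1.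
pose f : {linear R^o -> R^o} := lin_of (x : R^o).
have fE r : f r = r * x by [].
have B'm : {subset sumS J (imageS f (colon J K)) <= colon J m}.
  move=> y /sumSP[j jJ /imageSP[r /colonP rK ey]].
  rewrite -(subrK j y) ey; apply: idlD; last exact: sub_colon.
  by apply/colonP => c cm; rewrite fE -mulrA; apply: rK; rewrite mulrC; apply: mx.
have JB' := @sumSl _ _ J (imageS f (colon J K)).
have [a' [b' [ha' _ eab]]] := ilen_split JB' B'm type1.
have : ilen (colon J K1) (colon J K) a'.
  apply/(ilen_transfer (f := f) (A' := J) (B' := sumS J (imageS f (colon J K)))) => //.
  - exact: colon_sub.
  - by move=> r rK; apply: sumSr; apply/imageSP; exists r.
  - move=> r /colonP rK; rewrite fE; apply/idP/colonP => [rx b0|h].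
      move=> /sumlP[t ht]; rewrite -(subrK (t * x) b0) mulrDr; apply: idlD; first exact: rK.
      by rewrite mulrCA; apply: idlMl.
    by apply: h; apply: sumSr; apply: mem_line.
  - move=> y /sumSP[j jJ /imageSP[r rK ey]]; exists r => //.
    by rewrite -ey subKr.
move=> ha1; exists (q' + a')%N.
  by apply: ilen_add hq' ha1; apply: colon_sub.
by rewrite -addn1 leq_add // eab leq_addr.
Qed.

(** The bound [colon_ilen_le] is applied along J <= K <= L <= R. Since J:R = J and J:J = R, the
    three colon lengths also add up to length(R/J), so no bound is strict. *)
Lemma colon_ilen q K L : {subset J <= K} -> {subset K <= L} -> ilen K L q ->
  ilen (colon J L) (colon J K) q.
Proof.
move=> JK KL hq.
have JJ : {subset J <= J} by [].
have [N hN] := ilen_artin noe loc hJ JJ.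
have KR : {subset K <= fullS R^o} by [].
have LR : {subset L <= fullS R^o} by [].
have JL : {subset J <= L} by move=> x /JK/KL.
have [a [b [ha hb Nab]]] := ilen_split JK KR hN.
have [c [e [hc he bce]]] := ilen_split KL LR hb.
have qc := ilen_inj hq hc; subst c.
have [a' ha' aa'] := colon_ilen_le JJ JK ha.
have [q' hq' qq'] := colon_ilen_le JK KL hq.
have [e' he' ee'] := colon_ilen_le JL LR he.
have h : ilen (colon J (fullS R^o)) (colon J J) (e' + q' + a').
  apply: ilen_add ha'; try exact: colon_sub.
  by apply: ilen_add hq'; try exact: colon_sub.
have {}h : ilen J (fullS R^o) (e' + q' + a').
  apply: ilen_eq h; [exact: colon_full|exact: colon_self|exact: colon_sub].
have /eqP := ilen_inj hN h; rewrite Nab bce => eN.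
suff -> : q = q' by [].
apply/eqP; rewrite eqn_leq qq' andbT leqNgt; apply/negP => lt.
move/eqP: eN => eN; suff : (e' + q' + a' < a + (q + e))%N by rewrite eN ltnn.
rewrite addnC -addnS leq_add // addnC -addSn leq_add //.
Qed.

(** [K] lies in its double colon, and applying duality twice gives both the same colength. *)
Lemma colon_colon K : {subset J <= K} -> colon J (colon J K) =i K.
Proof.
move=> JK x.
have KR : {subset K <= fullS R^o} by [].
have [q hq] := ilen_artin noe loc hJ JK.
have sK : {subset K <= colon J (colon J K)}.
  by move=> y yK; apply/colonP => b /colonP h; rewrite mulrC; apply: h.
have h1 : ilen J (colon J K) q.
  apply: ilen_eq (colon_ilen JK KR hq) => //; [exact: colon_full|exact: colon_sub].
have JJK := @sub_colon R J K.
have h2 : ilen (colon J (colon J K)) (fullS R^o) q.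
  apply: ilen_eq (colon_ilen _ JJK h1) => //; [exact: colon_self|exact: colon_sub].
have [a [b [ha hb qab]]] := ilen_split sK (@sub_fullS _ _ _) hq.
have bq := ilen_inj hb h2; subst b.
have a0 : a = 0%N by move/eqP: qab; rewrite -{1}(add0n q) eqn_add2r => /eqP.
subst a; apply/idP/idP; [exact: ilen0P sK ha x|exact: sK].
Qed.

Lemma colon_power_ilen Q l : {subset J <= Q} -> ilen Q (fullS R^o) l ->
  ilen J (colon J Q) l.
Proof.
move=> JQ hl; apply: ilen_eq (colon_ilen JQ (@sub_fullS _ _ _) hl) => //.
  exact: colon_full.
exact: colon_sub.
Qed.

(* The minimal generators of the canonical module I / J of R / Q are dual to
   the socle of R / Q. *)
Lemma colon_generators_ilen Q n : {subset J <= Q} -> {subset Q <= colon Q m} ->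
  ilen Q (colon Q m) n ->
  ilen (sumS J (ideal_mul m (colon J Q))) (colon J Q) n.
Proof.
move=> JQ Qm hn; set I := colon J Q.
have QI := colon_colon JQ.
pose L := sumS J (ideal_mul m I).
have JL : {subset J <= L} by exact: sumSl.
(* J : mI = (J : I) : m, and J : I = Q by double duality; adding J to mI leaves the colon
   unchanged. *)
have eL : colon J L =i colon Q m.
  move=> r; apply/colonP/colonP => [h b bm|h b].
    rewrite -QI; apply/colonP => c cI; rewrite -mulrA; apply: h.
    by apply: sumSr; apply: mul_idl.
  move=> /sumSP[j jJ hb]; rewrite -(subrK j b) mulrDr; apply: idlD; last exact: idlMl.
  suff : {subset ideal_mul m I <= preimS (lin_of (r : R^o) : {linear R^o -> R^o}) J}.
    by move=> /(_ _ hb); rewrite mem_preim_mul mulrC.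
  apply: mul_idl_sub => a c am /colonP cI; rewrite mem_preim_mul mulrC.
  by rewrite mulrA mulrC; apply: cI; apply: h.
apply: ilen_eq (colon_ilen JQ Qm hn) => //; last exact: colon_sub.
by move=> x; rewrite -(colon_eqr J eL) (colon_colon JL).
Qed.

End Duality.

(** * Colons of powers of the maximal ideal *)

Section PowerColon.
Variables (R : comNzRingType) (m : ideal R) (z : seq R).
Hypotheses (noe : noetherian R) (loc : local_ring m).
Hypothesis zreg : regular_sequence z.
Let J := ideal_gen z.
Hypothesis hJ : forall P : ideal R, prime_ideal P -> {subset J <= P} -> P =i m.
Hypotheses (z_gt0 : (0 < size z)%N) (zm : {subset J <= ideal_exp m 2}).

Lemma exp_idl1 : ideal_exp m 1 =i m.
Proof.
move=> x; apply/idP/idP => [|xm]; first exact: mul_idl_subl.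
by rewrite -(mulr1 x); apply: mul_idl.
Qed.

(** Were m = m^2, a socle element of R modulo J : m would be sent into J by m^2 = m; hence J : m = R
    and m lies in J. Then z_0, being in m^2, is in J^2, and the syzygies of z make 1 - c_0 an
    element of J with c_0 in J. *)
Lemma local_neq_square : ~ {subset m <= ideal_exp m 2}.
Proof.
move=> m2; have [zr J1] := zreg.
have m2m : {subset m <= ideal_mul m m}.
  move=> x /m2; apply: mul_idl_sub => a b am bm; apply: mul_idl => //.
  by rewrite -exp_idl1.
have mJ : {subset m <= J}.
  suff h : {subset fullS R^o <= colon J m}.
    by move=> x xm; have /colonP := h 1 isT; move=> /(_ x xm); rewrite mul1r.
  apply: contrapT => /(socle_ex noe hJ (@sub_colon _ J m))[y [_ yJ my]].
  case/negP: yJ; apply/colonP => b /m2m hb.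
  suff : {subset ideal_mul m m <= preimS (lin_of (y : R^o) : {linear R^o -> R^o}) J}.
    by move=> /(_ _ hb); rewrite mem_preim_mul mulrC.
  apply: mul_idl_sub => r s rm sm; rewrite mem_preim_mul.
  by have /colonP/(_ s sm) := my r rm; rewrite mulrAC.
have : z`_0 \in ideal_mul J J.
  have : z`_0 \in ideal_mul m m.
    by apply: m2m; rewrite -exp_idl1; apply: mul_idl_subr (zm (mem_gen (mem_nth _ _))).
  by apply: mul_idl_sub => a b /mJ aJ /mJ bJ; apply: mul_idl.
move=> /mem_mul_gen[c [cJ e]].
have : \sum_(j < size z) ((j == 0%N :> nat)%:R - c j) * z`_j = 0.
  under eq_bigr do rewrite mulrBl.
  rewrite sumrB -e (bigD1 (Ordinal z_gt0)) //= mul1r big1 ?addr0 ?subrr // => i.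
  by rewrite -val_eqE /= => /negbTE->; rewrite mul0r.
move=> /(regular_coef zr (u := fun j => (j == 0%N)%:R - c j))/(_ 0%N z_gt0) /= h.
by case/negP: J1; rewrite -(subrK (c 0%N) 1); apply: idlD.
Qed.

(** For k = 1 the colon is R; for k = 2 an element outside m would be a unit sending m into m^2. *)
Lemma exp_colon s k :
  (forall j : nat, (3 <= j <= s)%N -> colon (ideal_exp m j) m =i ideal_exp m j.-1) ->
  (1 <= k <= s)%N -> colon (ideal_exp m k) m =i ideal_exp m k.-1.
Proof.
move=> h /andP[k1 ks]; case: k k1 ks => [|[|[|k]]] // _ ks; last exact: h.
  move=> x; rewrite [RHS](mem_fullS (M := R^o)); apply/colonP => b bm.
  by rewrite exp_idl1; apply: idlMl.
move=> x; rewrite exp_idl1; apply/idP/idP => [/colonP hx|xm].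
  apply: contrapT => /negP/(local_unit noe loc)[y yx].
  apply: local_neq_square => b bm; rewrite -(mul1r b) -yx -mulrA.
  by apply: idlMl; apply: hx.
by apply/colonP => b bm; apply: mul_idl => //; rewrite exp_idl1.
Qed.

End PowerColon.

(** * Symmetric squares *)

Section Sym2Theory.
Variables (R : comNzRingType) (M : lmodType R).

Lemma sym2_mkC (u v : M) : sym2_mk u v = sym2_mk v u.
Proof. by apply/quot_proj_eq; apply: mem_spanS; right; exists u, v. Qed.

Lemma sym2_mk_linear v : linear (@sym2_mk R M ^~ v).
Proof.
move=> a u u'; rewrite /sym2_mk /= -quot_proj_scale -quot_projD.
by apply/quot_proj_eq; apply: mem_spanS; left; exists a, u, u', v.
Qed.

Definition sym2_left (v u : M) : sym2 M := sym2_mk u v.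
HB.instance Definition _ v :=
  GRing.isLinear.Build R M (sym2 M) _ (sym2_left v) (sym2_mk_linear v).

Lemma sym2_mk_suml (I : Type) (s : seq I) (P : pred I) (F : I -> M) (v : M) :
  sym2_mk (\sum_(i <- s | P i) F i) v = \sum_(i <- s | P i) sym2_mk (F i) v.
Proof. exact: (linear_sum (sym2_left v : {linear _ -> _})). Qed.

Lemma sym2_mkZl a (u v : M) : sym2_mk (a *: u) v = a *: sym2_mk u v.
Proof. by rewrite -[LHS]/(sym2_left v (a *: u)) linearZ. Qed.

Lemma sym2_mkBl (u u' v : M) : sym2_mk (u - u') v = sym2_mk u v - sym2_mk u' v.
Proof. exact: (linearB (sym2_left v : {linear _ -> _})). Qed.

Lemma sym2_mk_sumr (I : Type) (s : seq I) (P : pred I) (F : I -> M) (v : M) :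
  sym2_mk v (\sum_(i <- s | P i) F i) = \sum_(i <- s | P i) sym2_mk v (F i).
Proof. by rewrite sym2_mkC sym2_mk_suml; apply: eq_bigr => i _; rewrite sym2_mkC. Qed.

Lemma sym2_mkZr a (u v : M) : sym2_mk v (a *: u) = a *: sym2_mk v u.
Proof. by rewrite sym2_mkC sym2_mkZl sym2_mkC. Qed.

Lemma sym2_ind (A : submodClosed (sym2 M)) :
  (forall u v, sym2_mk u v \in A) -> forall x, x \in A.
Proof.
move=> h x; rewrite -[x]quot_proj_repr; set y := repr x.
rewrite -[y]freeg_sumE (linear_sum (quot_proj (spanS (@sym2_rel R M)) : {linear _ -> _})).
apply: rpred_sum => -[u v] _ /=.
have -> : << coeff (u, v) y *g (u, v) >> = coeff (u, v) y *: sym2_gen u v.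
  by apply/eqP/freeg_eqP => q; rewrite /sym2_gen coeffZ !coeffU mulrA mulr1.
by rewrite quot_proj_scale; apply: rpredZ; apply: h.
Qed.

Lemma sym2_gens (s : seq M) (B : submodClosed (sym2 M)) :
  (forall A : submodClosed M, (forall x, x \in s -> x \in A) -> forall x, x \in A) ->
  (forall x y, x \in s -> y \in s -> sym2_mk x y \in B) -> forall x, x \in B.
Proof.
move=> gen h; apply: sym2_ind => u v.
have hv x : x \in s -> v \in preimS (sym2_left x : {linear _ -> _}) B.
  by move=> xs; apply: gen => y ys; rewrite mem_preimS; apply: h.
suff : u \in preimS (sym2_left v : {linear _ -> _}) B by [].
by apply: gen => y /hv; rewrite !mem_preimS /= /sym2_left sym2_mkC.
Qed.

Variable N : lmodType R.

Lemma sym2_lift_ex (f : M -> M -> N) :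
  (forall v, linear (f^~ v)) -> (forall u v, f u v = f v u) ->
  exists g : {linear sym2 M -> N}, forall u v, g (sym2_mk u v) = f u v.
Proof.
move=> fl fC.
pose g : {linear sym2 M -> N} := HB.pack (sym2_lift f)
  (GRing.isLinear.Build _ _ _ _ (sym2_lift f) (sym2_lift_is_linear fl fC)).
by exists g => u v; apply: sym2_lift_mk.
Qed.

Lemma sym2_eq (f g : {linear sym2 M -> N}) :
  (forall u v, f (sym2_mk u v) = g (sym2_mk u v)) -> f =1 g.
Proof.
move=> h x; have cl : submod_closed (fun x => f x == g x).
  split; first by rewrite -topredE /= !linear0.
  by move=> a u v /eqP hu /eqP hv; rewrite -topredE /= !linearP hu hv.
by apply/eqP; apply: (@sym2_ind (mk_submod cl)) => u v; apply/eqP.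
Qed.

End Sym2Theory.

(** The terms at (i, j) and (j, i) cancel in pairs; the diagonal is treated apart because 2 may be a
    zero divisor. *)
Lemma sum_alternating (R : comNzRingType) (N : lmodType R) n (F : 'I_n -> 'I_n -> N) :
  (forall i, F i i = 0) -> (forall i j, F i j = - F j i) ->
  \sum_i \sum_j F i j = 0.
Proof.
move=> F0 FN.
have -> : \sum_i \sum_j F i j =
    \sum_(i < n) \sum_(j < n | (j < i)%N) F i j + \sum_(i < n) \sum_(j < n | (i < j)%N) F i j.
  rewrite -big_split /=; apply: eq_bigr => i _.
  rewrite (bigD1 i) //= F0 add0r (bigID (fun j : 'I_n => (j < i)%N)) /=.
  congr (_ + _); apply: eq_bigl => j; rewrite -val_eqE /=; case: ltngtP => //.
rewrite [X in _ + X](exchange_big_dep predT) //= -big_split big1 //= => i _.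
rewrite -big_split big1 //= => j _; by rewrite FN addNr.
Qed.

Section SymSquareQuotient.
Variables (R : comNzRingType) (z : seq R) (I : ideal R).
Hypothesis zreg : forall i (x : R), (i < size z)%N ->
  x * z`_i \in ideal_gen (take i z) -> x \in ideal_gen (take i z).
Let J := ideal_gen z.
Hypothesis JI : {subset J <= I}.

Local Notation SI := (sub_mod I).
Local Notation V := (subquo I J).

Definition subquo_proj (x : SI) : V :=
  quot_proj (preimS (\val : {linear SI -> R^o}) J) x.
HB.instance Definition _ := GRing.isLinear.Build R SI V _ subquo_proj
  (@quot_proj_is_linear R SI (preimS (\val : {linear SI -> R^o}) J)).

Lemma subquo_proj0 x : (subquo_proj x == 0) = (\val x \in J).
Proof. exact: quot_proj0. Qed.

Lemma subquo_proj_repr (x : V) : subquo_proj (repr x) = x.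
Proof. exact: quot_proj_repr. Qed.

Lemma sym2_proj_ex : exists pi : {linear sym2 SI -> sym2 V},
  forall u v, pi (sym2_mk u v) = sym2_mk (subquo_proj u) (subquo_proj v).
Proof.
apply: sym2_lift_ex => [v a u u'|u v]; last exact: sym2_mkC.
by rewrite linearP; apply: sym2_mk_linear.
Qed.

Lemma mem_nth_gen j : z`_j \in I.
Proof.
have [jz|jz] := ltnP j (size z); first by apply: JI; apply: mem_gen; apply: mem_nth.
by rewrite nth_default //; apply: idl0.
Qed.

Definition zI j : SI := Sub (z`_j : R^o) (mem_nth_gen j).

Lemma mem_JE (t : SI) : \val t \in J -> exists c : nat -> R, t = \sum_(j < size z) c j *: zI j.
Proof.
move=> /mem_ideal_gen[c hc]; exists c; apply: val_inj.
by rewrite [RHS](linear_sum (\val : {linear SI -> R^o})) hc.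
Qed.

Lemma sym2_proj_ker (pi : {linear sym2 SI -> sym2 V}) :
  (forall u v, pi (sym2_mk u v) = sym2_mk (subquo_proj u) (subquo_proj v)) ->
  forall x, pi x = 0 <-> exists u : nat -> SI, x = \sum_(j < size z) sym2_mk (zI j) (u j).
Proof.
move=> hpi x; split=> [|[u ->]]; last first.
  rewrite linear_sum big1 // => j _.
  have zj : subquo_proj (zI j) = 0.
    apply/eqP; rewrite subquo_proj0; apply: mem_gen; exact: mem_nth.
  by rewrite hpi zj; apply: (linear0 (sym2_left _ : {linear _ -> _})).
pose P x := `[< exists u : nat -> SI, x = \sum_(j < size z) sym2_mk (zI j) (u j) >].
have cl : submod_closed P.
  split.
    apply/asboolP; exists (fun _ => 0); rewrite big1 // => j _.
    by rewrite sym2_mkC; apply: (linear0 (sym2_left _ : {linear _ -> _})).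
  move=> a _ _ /asboolP[u ->] /asboolP[v ->]; apply/asboolP.
  exists (fun j => a *: u j + v j); rewrite scaler_sumr -big_split /=.
  apply: eq_bigr => j _; rewrite ![sym2_mk (zI j) _]sym2_mkC.
  exact/esym/sym2_mk_linear.
set K := mk_submod cl.
have KJ t v : \val t \in J -> sym2_mk t v \in K.
  move=> /mem_JE[c ->]; apply/asboolP; exists (fun j => c j *: v).
  by rewrite sym2_mk_suml; apply: eq_bigr => j _; rewrite sym2_mkZl sym2_mkZr.
(* A left inverse of [pi] modulo the candidate kernel [K]: it multiplies representatives, and is
   well defined because products with elements of J lie in [K]. *)
have [h hh] : exists h : {linear sym2 V -> quot_mod K},
    forall u v, h (sym2_mk u v) = quot_proj K (sym2_mk (repr u) (repr v)).
  apply: sym2_lift_ex => [v a u u'|u v]; last by rewrite sym2_mkC.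
  rewrite -quot_proj_scale -quot_projD; apply/quot_proj_eq.
  rewrite -(sym2_mk_linear (repr v)) -sym2_mkBl; apply: KJ.
  rewrite -subquo_proj0 linearB linearP /=.
  by rewrite !subquo_proj_repr subrr.
have hpiE y : h (pi y) = quot_proj K y.
  apply: (sym2_eq (f := h \o pi) (g := quot_proj K)) => u v.
  rewrite /= hpi hh; apply/quot_proj_eq.
  have hr (w : SI) : \val (repr (subquo_proj w) - w) \in J.
    by rewrite -subquo_proj0 linearB /= subquo_proj_repr subrr.
  have -> : sym2_mk (repr (subquo_proj u)) (repr (subquo_proj v)) - sym2_mk u v =
      sym2_mk (repr (subquo_proj u) - u) (repr (subquo_proj v)) +
      sym2_mk (repr (subquo_proj v) - v) u.
    by rewrite !sym2_mkBl (sym2_mkC _ u) (sym2_mkC v u) addrA subrK.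
  by rewrite rpredD //; apply: KJ.
move=> px; apply/asboolP; rewrite -[asbool _]/(x \in K) -quot_proj0 -hpiE px.
by rewrite linear0.
Qed.

Let phi : {linear sym2 SI -> sub_mod (ideal_mul I I)} := @sym2_to_square R I.

Lemma phi_mk_sum (u : nat -> SI) :
  \val (phi (\sum_(j < size z) sym2_mk (zI j) (u j))) =
    \sum_(j < size z) \val (u j) * z`_j :> R.
Proof.
rewrite linear_sum (linear_sum (\val : {linear _ -> R^o})); apply: eq_bigr => j _.
by rewrite /= sym2_to_square_mk mulrC.
Qed.

(* A relation sum u_j z_j = 0 is Koszul, hence so is the element
   sum z_j u_j of S_2(I), which vanishes by antisymmetry. *)
Lemma sym2_mk_sum_eq0 (u : nat -> SI) :
  phi (\sum_(j < size z) sym2_mk (zI j) (u j)) = 0 ->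
  \sum_(j < size z) sym2_mk (zI j) (u j) = 0.
Proof.
move=> hu; have := phi_mk_sum u; rewrite hu => /esym.
move=> /(regular_syzygy zreg (leqnn _) (u := fun j => \val (u j)))[c [c0 cN hc]].
have -> : \sum_(j < size z) sym2_mk (zI j) (u j) =
    \sum_(j < size z) \sum_(l < size z) c j l *: sym2_mk (zI j) (zI l).
  apply: eq_bigr => j _; have -> : u j = \sum_(l < size z) c j l *: zI l.
    apply: val_inj; rewrite [RHS](linear_sum (\val : {linear SI -> R^o})) hc //.
  by rewrite sym2_mk_sumr; apply: eq_bigr => l _; rewrite sym2_mkZr.
apply: sum_alternating => [j|j l]; first by rewrite c0 scale0r.
by rewrite cN scaleNr sym2_mkC.
Qed.

(** S_2(I/J) is filtered by the image of delta(I), on which the projection is injective. What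
    remains is S_2(I) modulo delta(I) and the kernel of the projection, which multiplication
    identifies with I^2 / JI. *)
Lemma ilen_sym2_quotient r : ilen (zeroS (sym2 V)) (fullS (sym2 V)) r ->
  exists a b, [/\ ilen (zeroS (sym2 SI)) (kerS phi) a,
                  ilen (ideal_mul J I) (ideal_mul I I) b & r = (a + b)%N].
Proof.
move=> hr; have [pi hpi] := sym2_proj_ex; have pik := sym2_proj_ker hpi.
set D := kerS phi.
have [a [b [ha hb ->]]] := ilen_split (@zeroS_sub _ _ (imageS pi D)) (@sub_fullS _ _ _) hr.
exists a, b; split=> //.
- apply/(ilen_transfer (f := pi) (A' := zeroS _) (B' := imageS pi D)); last exact: ha.
  + exact: zeroS_sub.
  + exact: zeroS_sub.
  + by move=> x xD; apply/imageSP; exists x.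
  + move=> x; rewrite mem_kerS => /eqP phx; rewrite !mem_zeroS.
    apply/eqP/eqP => [/pik[u xu]|->]; last by rewrite linear0.
    by rewrite xu; apply: sym2_mk_sum_eq0; rewrite -xu.
  + by move=> y /imageSP[x xD ->]; exists x; rewrite // subrr rpred0.
- pose A := preimS pi (imageS pi D).
  have hA : ilen A (fullS (sym2 SI)) b.
    apply/(ilen_transfer (f := pi) (A' := imageS pi D) (B' := fullS _)) => //.
    move=> y _.
    suff /imageSP[x _ ->] : y \in imageS pi (fullS _).
      by exists x; rewrite // subrr rpred0.
    apply: sym2_ind => u v; apply/imageSP; exists (sym2_mk (repr u) (repr v)) => //.
    by rewrite hpi !subquo_proj_repr.
  pose f : {linear sym2 SI -> R^o} := (\val : {linear sub_mod (ideal_mul I I) -> R^o}) \o phi.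
  have fE x : f x = \val (phi x) by [].
  suff /iffLR/(_ hA) : ilen A (fullS _) b <-> ilen (ideal_mul J I) (ideal_mul I I) b by [].
  apply: (ilen_transfer (f := f)) => //.
  + apply: mul_idl_sub => x y /JI xI yI; exact: mul_idl.
  + by move=> x _; rewrite fE; apply: valP.
  + move=> x _; rewrite fE mem_preimS; apply/idP/imageSP => [|[d]].
      move=> /mem_mul_gen[c [cI hc]].
      pose u j : SI := Sub (c j : R^o) (cI j).
      pose y := \sum_(j < size z) sym2_mk (zI j) (u j).
      have py : pi y = 0 by apply/pik; exists u.
      exists (x - y); last by rewrite linearB py subr0.
      rewrite mem_kerS linearB subr_eq0; apply/eqP/val_inj.
      by rewrite phi_mk_sum hc.
    rewrite mem_kerS => /eqP hd xd.
    have /pik[u xu] : pi (x - d) = 0 by rewrite linearB xd subrr.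
    have -> : phi x = phi (x - d) by rewrite linearB hd subr0.
    rewrite xu phi_mk_sum; apply: idl_sum => j _; rewrite mulrC.
    by apply: mul_idl; [apply: mem_gen; apply: mem_nth|apply: valP].
  + move=> y yI2.
    suff /imageSP[x _ ->] : y \in imageS f (fullS _).
      by exists x; rewrite // subrr rpred0.
    move: y yI2; apply: mul_idl_sub => x y xI yI; apply/imageSP.
    exists (sym2_mk (Sub (x : R^o) xI : SI) (Sub (y : R^o) yI : SI)) => //.
    by rewrite fE sym2_to_square_mk.
Qed.

End SymSquareQuotient.

(** * First Koszul homology *)

Section KoszulH1.
Variables (R : comNzRingType) (n : nat) (a : n.-tuple R) (I : ideal R).
Hypothesis eI : I =i ideal_gen a.

Local Notation set2 i j := (finset.setU (finset.set1 i) (finset.set1 j)).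
Local Notation Rn := {ffun 'I_n -> R^o}.

Definition dot (v : Rn) : R^o := \sum_i v i * tnth a i.
Lemma dot_is_linear : linear dot.
Proof.
move=> r u v; rewrite /dot scaler_sumr -big_split /=.
by apply: eq_bigr => i _; rewrite !ffunE mulrDl scalerAl.
Qed.
HB.instance Definition _ := GRing.isLinear.Build R Rn R^o _ dot dot_is_linear.

Definition syzygies := kerS (dot : {linear Rn -> R^o}).

Lemma mem_syzygies v : (v \in syzygies) = (dot v == 0).
Proof. by []. Qed.

Lemma coef_ideal_closed :
  submod_closed (fun v : Rn => [forall i, (v i : R) \in I]).
Proof.
split; first by apply/forallP => i; rewrite ffunE; apply: idl0.
move=> r u v /forallP hu /forallP hv; apply/forallP => i; rewrite !ffunE.
by apply: idlD => //; apply: idlMl.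
Qed.
Definition coef_ideal := mk_submod coef_ideal_closed.

Lemma mem_coef_ideal (v : Rn) : reflect (forall i, (v i : R) \in I) (v \in coef_ideal).
Proof. exact: forallP. Qed.

(** Degree 1 boundaries are described by alternating matrices, which avoids coordinates indexed by
    two-element sets. *)
Lemma koszul_bd_closed : submod_closed (fun v : Rn =>
  `[< exists c : 'I_n -> 'I_n -> R, [/\ forall i, c i i = 0,
        forall i j, c i j = - c j i & forall i, v i = \sum_j c i j * tnth a j] >]).
Proof.
split.
  apply/asboolP; exists (fun _ _ => 0); split=> // [i j|i]; first by rewrite oppr0.
  by rewrite ffunE big1 // => j _; rewrite mul0r.
move=> r u v /asboolP[c [c0 cN hc]] /asboolP[e [e0 eN he]]; apply/asboolP.
exists (fun i j => r * c i j + e i j); split=> [i|i j|i].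
- by rewrite c0 e0 mulr0 addr0.
- by rewrite cN eN mulrN -opprD.
- rewrite !ffunE hc he [_ *: _]mulr_sumr -big_split /=.
  by apply: eq_bigr => j _; rewrite mulrDl mulrA.
Qed.
Definition koszul_bd := mk_submod koszul_bd_closed.

Lemma koszul_bdP (v : Rn) : reflect (exists c : 'I_n -> 'I_n -> R,
    [/\ forall i, c i i = 0, forall i j, c i j = - c j i
      & forall i, v i = \sum_j c i j * tnth a j]) (v \in koszul_bd).
Proof. exact: asboolP. Qed.

Lemma mem_genP x : x \in I <-> exists c : 'I_n -> R, x = \sum_i c i * tnth a i.
Proof.
rewrite eI mem_ideal_gen size_tuple; split=> [[c ->]|[c ->]].
  by exists (fun i => c i); apply: eq_bigr => i _; rewrite (tnth_nth 0).
exists (fun j => if insub j is Some i then c i else 0).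
by apply: eq_bigr => i _; rewrite valK (tnth_nth 0).
Qed.

Lemma mem_gen_tnth i : tnth a i \in I.
Proof. by rewrite eI; apply: mem_gen; apply: mem_tnth. Qed.

Lemma koszul_bd_coef : {subset koszul_bd <= coef_ideal}.
Proof.
move=> v /koszul_bdP[c [_ _ hc]]; apply/mem_coef_ideal => i.
by rewrite hc; apply/mem_genP; exists (c i).
Qed.

Lemma koszul_bd_syz : {subset koszul_bd <= syzygies}.
Proof.
move=> v /koszul_bdP[c [c0 cN hc]]; rewrite mem_syzygies /dot.
rewrite (eq_bigr (fun i => \sum_j (c i j * tnth a j * tnth a i : R^o))); last first.
  by move=> i _; rewrite hc mulr_suml.
rewrite sum_alternating // => [i|i j]; first by rewrite c0 !mul0r.
by rewrite cN !mulNr mulrAC.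
Qed.

Lemma koszul_d0 (y : koszul R n) :
  koszul_d a y finset.set0 = \sum_i tnth a i *: y (finset.set1 i).
Proof.
rewrite ffunE; apply: eq_big => [i|i _]; first by rewrite inE.
rewrite finset.setU0; congr (_ *: _).
rewrite [X in (-1) ^+ X](_ : _ = 0%N) ?expr0 ?mul1r //.
by apply: eq_card0 => j; rewrite !inE.
Qed.

Lemma koszul_d1 (x : koszul R n) (i : 'I_n) :
  koszul_d a x (finset.set1 i) = \sum_(j | j != i)
    ((if (i < j)%N then -1 else 1) * tnth a j) *: x (set2 j i).
Proof.
rewrite ffunE; apply: eq_big => [j|j]; first by rewrite inE.
rewrite inE => ji; congr (((_ : R) * _) *: _); case: ltnP => ij.
  rewrite [X in (-1) ^+ X](_ : _ = 1%N) ?expr1 //.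
  apply/eqP/cards1P; exists i; apply/setP => l; rewrite !inE.
  by case: eqP => // ->.
rewrite [X in (-1) ^+ X](_ : _ = 0%N) ?expr0 //.
apply: eq_card0 => l; rewrite !inE; case: eqP => // -> /=.
by rewrite ltnNge ij.
Qed.

Lemma koszul_degP p (y : koszul R n) :
  reflect (forall A : {set 'I_n}, #|A| != p -> y A = 0) (y \in koszul_deg R n p).
Proof.
apply: (iffP forallP) => h A; last by apply/implyP => /h->.
by move=> hA; apply/eqP; apply: (implyP (h A)).
Qed.

Lemma koszul_d_deg p (y : koszul R n) :
  y \in koszul_deg R n p.+1 -> koszul_d a y \in koszul_deg R n p.
Proof.
move=> /koszul_degP hy; apply/koszul_degP => A hA; rewrite ffunE big1 // => i iA.
by rewrite hy ?scaler0 // cardsU1 iA add1n eqSS.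
Qed.

Definition singles (x : koszul R n) : Rn := [ffun i => x (finset.set1 i)].
Lemma singles_is_linear : linear singles.
Proof. by move=> r u v; apply/ffunP => i; rewrite !ffunE. Qed.
HB.instance Definition _ :=
  GRing.isLinear.Build R (koszul R n) Rn _ singles singles_is_linear.

Lemma dot_singles (y : koszul R n) : dot (singles y) = koszul_d a y finset.set0.
Proof.
by rewrite koszul_d0; apply: eq_bigr => i _; rewrite ffunE mulrC.
Qed.

Lemma singles_d (x : koszul R n) : singles (koszul_d a x) \in koszul_bd.
Proof.
apply/koszul_bdP.
exists (fun i j : 'I_n => if i == j then 0 else
          (if (i < j)%N then -1 else 1) * x (set2 j i)).
split=> [i|i j|i]; first by rewrite eqxx.
- rewrite eq_sym; case: eqVneq => [|ne]; first by rewrite oppr0.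
  rewrite finset.setUC; move: ne; rewrite -val_eqE /=.
  by case: ltngtP => // _ _; rewrite !(mulN1r, mul1r) ?opprK.
- rewrite ffunE koszul_d1 [RHS](bigD1 i) //= eqxx mul0r add0r.
  apply: eq_bigr => j ji; by rewrite eq_sym (negbTE ji) [LHS]mulrAC.
Qed.

Lemma set2_ord_inj (i j k l : 'I_n) : (j < i)%N -> (l < k)%N ->
  set2 i j = set2 k l -> i = k /\ j = l.
Proof.
move=> ji lk e.
have := finset.set21 i j; have := finset.set22 i j.
have := finset.set21 k l; have := finset.set22 k l.
rewrite e -{1 2}e !inE => /orP[]/eqP h1 /orP[]/eqP h2 /orP[]/eqP h3 /orP[]/eqP h4;
  subst => //; move: ji lk; rewrite ?ltnn // => h h';
  by move: (ltn_trans h h'); rewrite ltnn.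
Qed.

Lemma koszul_bd_lift (v : Rn) : v \in koszul_bd ->
  exists2 x : koszul R n, x \in koszul_deg R n 2 & singles (koszul_d a x) = v.
Proof.
move=> /koszul_bdP[c [c0 cN hc]].
(* A two-element set receives the entry of [c] below the diagonal; the ordered pair with the larger
   index first is determined by the set. *)
pose x : koszul R n := [ffun A =>
  if [pick p : 'I_n * 'I_n | (A == set2 p.1 p.2) && (p.2 < p.1)%N] is Some p
  then c p.1 p.2 else 0].
have xE (i j : 'I_n) : (j < i)%N -> x (set2 i j) = c i j.
  move=> ji; rewrite ffunE; case: pickP => [[k l] /= /andP[/eqP e lk]|/(_ (i, j))].
    by have [-> ->] := set2_ord_inj ji lk e.
  by rewrite /= eqxx ji.
exists x.
  apply/koszul_degP => A hA; rewrite ffunE; case: pickP => // -[k l] /= /andP[/eqP eA lk].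
  case/negP: hA; rewrite eA cards2.
  by have -> : k != l by rewrite -val_eqE /= gtn_eqF.
apply/ffunP => i; rewrite ffunE koszul_d1 hc [RHS](bigD1 i) //= c0 mul0r add0r.
apply: eq_bigr => j ji; move: (ji); rewrite -val_eqE neq_ltn /= => /orP[jlt|ilt].
  rewrite ltnNge (ltnW jlt) /= finset.setUC xE // mul1r.
  by rewrite [LHS]mulrC.
by rewrite ilt xE // mulN1r [LHS]mulNr mulrC -mulNr -cN.
Qed.

Lemma ilen_koszul_H1 l : has_length (koszul_H a 1) l <-> ilen koszul_bd syzygies l.
Proof.
pose f : {linear koszul R n -> Rn} := singles.
set A := imageS (koszul_d a) (koszul_deg R n 2).
set B := capS (koszul_deg R n 1) (kerS (koszul_d a)).
have mB (y : koszul R n) : y \in koszul_deg R n 1 ->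
    (koszul_d a y == 0) = (dot (singles y) == 0).
  move=> y1; rewrite dot_singles; apply/eqP/eqP => [->|h]; first by rewrite ffunE.
  apply/ffunP => C; rewrite [RHS]ffunE; have [->//|C0] := eqVneq C finset.set0.
  by move/koszul_degP: (koszul_d_deg y1); apply; rewrite cards_eq0.
have inj (y : koszul R n) : y \in koszul_deg R n 1 -> singles y = 0 -> y = 0.
  move=> /koszul_degP y1 /ffunP s0; apply/ffunP => C; rewrite [RHS]ffunE.
  have [/eqP/cards1P[i ->]|C1] := eqVneq #|C| 1%N; last exact: y1.
  by have := s0 i; rewrite !ffunE.
have AB : {subset A <= B}.
  move=> _ /imageSP[x x2 ->]; rewrite mem_capS koszul_d_deg //.
  rewrite mem_kerS mB; last exact: koszul_d_deg.
  exact: koszul_bd_syz (singles_d x).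
apply: (iff_trans (ilen_subquo _ AB)).
apply: (ilen_transfer (f := f)) => //.
- exact: koszul_bd_syz.
- by move=> y; rewrite mem_capS mem_kerS => /andP[y1]; rewrite mB.
- move=> y; rewrite mem_capS => /andP[y1 _]; apply/idP/imageSP => [|[x x2 ->]].
    move=> /koszul_bd_lift[x x2 sx]; exists x => //.
    apply/eqP; rewrite -subr_eq0; apply/eqP; apply: inj.
      by apply: rpredBZ => //; apply: koszul_d_deg.
    by rewrite linearB /= [singles (koszul_d a x)]sx subrr.
  exact: singles_d.
- move=> v; rewrite mem_syzygies => hv.
  pose y : koszul R n := [ffun C => \sum_(i | C == finset.set1 i) v i].
  have yv : singles y = v.
    apply/ffunP => i; rewrite !ffunE (big_pred1 i) // => j.
    by rewrite (inj_eq finset.set1_inj) eq_sym.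
  exists y; last by rewrite [f y]yv subrr rpred0.
  have y1 : y \in koszul_deg R n 1.
    apply/koszul_degP => C hC; rewrite ffunE big1 // => i /eqP eC.
    by rewrite eC cards1 in hC.
  by rewrite mem_capS y1 mem_kerS mB // yv.
Qed.

Local Notation SI := (sub_mod I).
Local Notation SIn := {ffun 'I_n -> sub_mod I}.

Definition aI i : SI := Sub (tnth a i : R^o) (mem_gen_tnth i).

Definition valn (u : SIn) : Rn := [ffun i => \val (u i)].
Lemma valn_is_linear : linear valn.
Proof. by move=> r u v; apply/ffunP => i; rewrite !ffunE. Qed.
HB.instance Definition _ := GRing.isLinear.Build R SIn Rn _ valn valn_is_linear.

Definition symn (u : SIn) : sym2 SI := \sum_i sym2_mk (u i) (aI i).
Lemma symn_is_linear : linear symn.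
Proof.
move=> r u v; rewrite /symn scaler_sumr -big_split /=.
by apply: eq_bigr => i _; rewrite !ffunE; apply: sym2_mk_linear.
Qed.
HB.instance Definition _ := GRing.isLinear.Build R SIn (sym2 SI) _ symn symn_is_linear.

Definition scaled (c : 'I_n -> R) (y : R) : Rn := [ffun i => c i * y].

(** This is the fact that I annihilates H_1(I): for y = sum e_j a_j, the alternating matrix c_i e_j
    - c_j e_i sends a to c y, because c is a relation. *)
Lemma relation_koszul_bd (c : 'I_n -> R) (y : R) : y \in I ->
  \sum_i c i * tnth a i = 0 -> scaled c y \in koszul_bd.
Proof.
move=> /mem_genP[e ->] hc; apply/koszul_bdP.
exists (fun i j => c i * e j - c j * e i); split=> [i|i j|i].
- by rewrite subrr.
- by rewrite opprB.
- rewrite ffunE mulr_sumr.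
  have -> : \sum_j (c i * e j - c j * e i) * tnth a j =
      \sum_j c i * (e j * tnth a j) - e i * \sum_j c j * tnth a j.
    by rewrite mulr_sumr -sumrB; apply: eq_bigr => j _; ring.
  by rewrite hc mulr0 subr0.
Qed.

(** For the harder inclusion, a map from S_2(I) to R^n modulo boundaries sends xy to y times the
    coordinates of x in the generators. Coordinates are defined up to a relation, which
    [relation_koszul_bd] absorbs, and the composite with [symn] is the class of [valn u]. *)
Lemma symn_eq0 (u : SIn) : (symn u == 0) = (valn u \in koszul_bd).
Proof.
apply/eqP/idP => [hu|/koszul_bdP[c [c0 cN hc]]]; last first.
  rewrite /symn (eq_bigr (fun i => \sum_j c i j *: sym2_mk (aI j) (aI i))) => [|i _].
    apply: sum_alternating => [i|i j]; first by rewrite c0 scale0r.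
    by rewrite cN scaleNr sym2_mkC.
  have -> : u i = \sum_j c i j *: aI j.
    apply: val_inj; rewrite [RHS](linear_sum (\val : {linear SI -> R^o})).
    by have := hc i; rewrite ffunE.
  by rewrite sym2_mk_suml; apply: eq_bigr => j _; rewrite sym2_mkZl.
have [q hq] : exists q : SI -> 'I_n -> R, forall x, \val x = \sum_i q x i * tnth a i :> R.
  have h (x : SI) : exists c : 'I_n -> R, \val x = \sum_i c i * tnth a i :> R.
    by apply/mem_genP/valP.
  by have [q hq] := choice h; exists q.
pose F (x y : SI) := quot_proj koszul_bd (scaled (q x) (\val y)).
have [h hh] : exists h : {linear sym2 SI -> quot_mod koszul_bd},
    forall x y, h (sym2_mk x y) = F x y.
  apply: sym2_lift_ex => [y r x x'|x y].
    rewrite /F -quot_proj_scale -quot_projD; apply/quot_proj_eq.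
    pose c i := q (r *: x + x') i - (r * q x i + q x' i).
    have -> : scaled (q (r *: x + x')) (\val y) -
        (r *: scaled (q x) (\val y) + scaled (q x') (\val y)) = scaled c (\val y).
      by apply/ffunP => i; rewrite !ffunE /c mulrBl mulrDl -mulrA.
    apply: relation_koszul_bd; first exact: valP.
    under eq_bigr do rewrite mulrBl mulrDl -mulrA.
    by rewrite sumrB big_split /= -mulr_sumr -!hq subrr.
  apply/quot_proj_eq/koszul_bdP.
  (* This alternating matrix witnesses the symmetry in x and y modulo boundaries. *)
  exists (fun i j => q x i * q y j - q y i * q x j); split=> [i|i j|i].
  - by rewrite mulrC subrr.
  - by rewrite opprB (mulrC (q y j)) (mulrC (q x j)).
  - rewrite !ffunE !hq !mulr_sumr -sumrB; apply: eq_bigr => j _; ring.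
have : h (symn u) = quot_proj koszul_bd (valn u).
  rewrite linear_sum.
  have -> : valn u = \sum_i scaled (fun j => (i == j)%:R) (\val (u i)).
    apply/ffunP => j; rewrite sum_ffunE ffunE (bigD1 j) //= ffunE eqxx mul1r.
    by rewrite big1 ?addr0 // => i ij; rewrite ffunE (negbTE ij) mul0r.
  rewrite (linear_sum (quot_proj koszul_bd : {linear _ -> _})); apply: eq_bigr => i _.
  rewrite sym2_mkC hh; apply/quot_proj_eq.
  pose c j := q (aI i) j - (i == j)%:R.
  have -> : scaled (q (aI i)) (\val (u i)) - scaled (fun j => (i == j)%:R) (\val (u i)) =
      scaled c (\val (u i)).
    by apply/ffunP => j; rewrite !ffunE -mulrBl.
  apply: relation_koszul_bd; first exact: valP.
  under eq_bigr do rewrite mulrBl.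
  rewrite sumrB -hq (bigD1 i) //= eqxx mul1r big1 ?addr0 ?subrr // => j ji.
  by rewrite eq_sym (negbTE ji) mul0r.
rewrite hu linear0 => /esym/eqP; by rewrite quot_proj0.
Qed.

(** [symn] maps I^n onto S_2(I), and followed by multiplication it is the dot product with a. So
    delta(I) is the part of H_1(I) coming from syzygies with coefficients in I. *)
Lemma ilen_delta l : ilen (zeroS (sym2 SI)) (kerS (@sym2_to_square R I)) l <->
  ilen koszul_bd (capS syzygies coef_ideal) l.
Proof.
pose g : {linear SIn -> Rn} := valn; pose f : {linear SIn -> sym2 SI} := symn.
have bdsub : {subset koszul_bd <= capS syzygies coef_ideal}.
  by move=> v vb; rewrite mem_capS koszul_bd_syz ?koszul_bd_coef.
have AB : {subset preimS g koszul_bd <= preimS g syzygies}.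
  by move=> u; rewrite !mem_preimS => /koszul_bd_syz.
have squareE u : \val (sym2_to_square (symn u)) = dot (valn u).
  rewrite (linear_sum (sym2_to_square (I := I) : {linear _ -> _})).
  rewrite (linear_sum (\val : {linear _ -> R^o})).
  apply: eq_bigr => i _; rewrite ffunE; exact: (sym2_to_square_mk (u i) (aI i)).
apply: (@iff_trans _ (ilen (preimS g koszul_bd) (preimS g syzygies) l)).
  apply: iff_sym; apply: (ilen_transfer (f := f)) => //.
  - exact: zeroS_sub.
  - move=> u; rewrite mem_preimS mem_syzygies mem_kerS => /eqP hu.
    by apply/eqP/val_inj; rewrite /= squareE hu.
  - by move=> u _; rewrite mem_zeroS symn_eq0.
  - move=> x; rewrite mem_kerS => /eqP hx.
    have /imageSP[u _ xu] : x \in imageS f (fullS _).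
      apply: sym2_ind => x1 x2; apply/imageSP.
      have /mem_genP[c hc] := valP x1; exists [ffun i => c i *: x2] => //.
      have -> : x1 = \sum_i c i *: aI i.
        by apply: val_inj; rewrite [RHS](linear_sum (\val : {linear SI -> R^o})).
      rewrite sym2_mk_suml; apply: eq_bigr => i _.
      by rewrite ffunE !sym2_mkZl sym2_mkC.
    exists u; last by rewrite xu subrr rpred0.
    by rewrite mem_preimS mem_syzygies -squareE -[symn u]xu hx.
apply: (ilen_transfer (f := g)) => //.
- move=> u; rewrite mem_preimS mem_capS => -> /=.
  by apply/mem_coef_ideal => i; rewrite ffunE; apply: valP.
- move=> v; rewrite mem_capS => /andP[vZ /mem_coef_ideal vI].
  pose u : SIn := [ffun i => Sub (v i) (vI i)].
  have uv : valn u = v by apply/ffunP => i; rewrite !ffunE.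
  by exists u; rewrite ?mem_preimS [g u]uv // subrr rpred0.
Qed.

(** The dot product maps R^n onto I, and the inverse image of I^2 is the sum of [coef_ideal] and
    [syzygies]; this splits (R/I)^n into a syzygy part and I / I^2. *)
Lemma ilen_syzygies l : ilen I (fullS R^o) l ->
  exists e f, [/\ ilen (capS syzygies coef_ideal) syzygies e,
                  ilen (ideal_mul I I) I f & (n * l)%N = (e + f)%N].
Proof.
move=> hl.
have h : ilen coef_ideal (fullS Rn) (n * l).
  rewrite -[X in (X * l)%N]card_ord.
  pose del (i : 'I_n) : Rn := [ffun j => (i == j)%:R].
  have delE (c : 'I_n -> R) : \sum_i c i *: del i = [ffun i => c i].
    apply/ffunP => j; rewrite sum_ffunE ffunE (bigD1 j) //= !ffunE eqxx.
    rewrite [_ *: _]mulr1 big1 ?addr0 // => i ij.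
    by rewrite !ffunE (negbTE ij) [LHS]mulr0.
  apply: (@ilen_free _ _ _ del _ _ I) => //.
  - move=> v _; exists v; rewrite delE.
    by have -> : [ffun i => v i] = v; [apply/ffunP => i; rewrite ffunE|rewrite subrr rpred0].
  - move=> i r rI; apply/mem_coef_ideal => j; rewrite !ffunE; exact: idlMr.
  - by move=> c; rewrite delE => /mem_coef_ideal h i; have := h i; rewrite ffunE.
have [e [f [he hf ef]]] := ilen_split (@sumSl _ _ coef_ideal syzygies) (@sub_fullS _ _ _) h.
exists e, f; split=> //.
  apply/(ilen_transfer (f := idfun : {linear Rn -> Rn}) (A' := coef_ideal)
    (B' := sumS coef_ideal syzygies)) => //.
  - by move=> v; rewrite mem_capS => /andP[].
  - exact: sumSl.
  - by move=> v vZ; apply: sumSr.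
  - by move=> v vZ; rewrite mem_capS vZ.
  - move=> v /sumSP[u uI vu]; exists (v - u) => //.
    by rewrite /= subKr.
suff /iffLR/(_ hf) : ilen (sumS coef_ideal syzygies) (fullS Rn) f <->
  ilen (ideal_mul I I) I f by [].
apply: (ilen_transfer (f := dot : {linear Rn -> R^o})) => //.
- exact: mul_idl_subl.
- by move=> v _; apply/mem_genP; exists v.
- move=> v _; apply/idP/sumSP => [hv|[u /mem_coef_ideal uI]].
    have /mem_mul_gen[c [cI hc]] : dot v \in ideal_mul (ideal_gen a) I.
      move: hv; apply: mul_idl_sub => x y xI yI; apply: mul_idl => //.
      by rewrite -eI.
    exists [ffun i : 'I_n => c i : R^o].
      by apply/mem_coef_ideal => i; rewrite ffunE.
    rewrite mem_syzygies linearB subr_eq0; apply/eqP; rewrite [LHS]hc size_tuple.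
    by apply: eq_bigr => i _; rewrite ffunE (tnth_nth 0).
  rewrite mem_syzygies linearB subr_eq0 => /eqP->.
  apply: idl_sum => i _; apply: mul_idl => //; exact: mem_gen_tnth.
- move=> x /mem_genP[c ->]; exists [ffun i => c i] => //.
  have -> : \sum_i c i * tnth a i = dot [ffun i => c i].
    by apply: eq_bigr => i _; rewrite ffunE.
  by rewrite subrr; apply: idl0.
Qed.

End KoszulH1.

(** * Residue space of the symmetric square *)

Section Sym2Residue.
Variables (R : comNzRingType) (m : ideal R) (z s : seq R) (I : ideal R).
Hypotheses (noe : noetherian R) (loc : local_ring m).
Hypothesis minI : minimal_generators (z ++ s) I.
Let J := ideal_gen z.
Let t := size s.

Local Notation SI := (sub_mod I).
Local Notation V := (subquo I J).

Lemma mem_s i : s`_i \in I.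
Proof.
have [it|it] := ltnP i (size s); last by rewrite nth_default //; apply: idl0.
by rewrite minI.1; apply: mem_gen; rewrite mem_cat mem_nth ?orbT.
Qed.

Definition sV (i : 'I_t) : V := subquo_proj z (Sub (s`_i : R^o) (mem_s i) : SI).

Lemma sV_sum (c : 'I_t -> R) (y : SI) :
  \val y - \sum_i c i * s`_i \in J -> subquo_proj z y = \sum_i c i *: sV i.
Proof.
move=> h; apply/eqP; rewrite -subr_eq0.
have -> : \sum_i c i *: sV i =
    subquo_proj z (\sum_i c i *: (Sub (s`_i : R^o) (mem_s i) : SI)).
  rewrite (linear_sum (@subquo_proj R z I : {linear _ -> _})); apply: eq_bigr => i _.
  by rewrite linearZ.
rewrite -linearB subquo_proj0 linearB (linear_sum (\val : {linear SI -> R^o})).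
exact: h.
Qed.

Lemma sV_gen (x : V) : exists c : 'I_t -> R, x = \sum_i c i *: sV i.
Proof.
pose y : SI := repr x; have : \val y \in I := valP y.
rewrite minI.1 => /mem_ideal_gen[c hc].
exists (fun i : 'I_t => c (size z + i)%N).
rewrite -(subquo_proj_repr x); apply: sV_sum; rewrite -/y hc size_cat big_split_ord /=.
have -> : \sum_(i < size s) c (size z + i)%N * (z ++ s)`_(size z + i) =
    \sum_(i < t) c (size z + i)%N * s`_i.
  by apply: eq_bigr => i _; rewrite nth_cat ltnNge leq_addr /= addKn.
rewrite addrK -[_ \in _]/(_ \in J); apply: idl_sum => i _; apply: idlMl; apply: mem_gen.
by rewrite nth_cat ltn_ord mem_nth.
Qed.

Lemma sV_indep (c : 'I_t -> R) : \sum_i c i *: sV i = 0 -> forall i, c i \in m.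
Proof.
move=> hc; apply: (minimal_independent noe loc minI); apply: sumSl.
pose y : SI := \sum_i c i *: (Sub (s`_i : R^o) (mem_s i) : SI).
have yE : \val y = \sum_i c i *: (s`_i : R^o).
  by rewrite (linear_sum (\val : {linear SI -> R^o})).
rewrite -yE -subquo_proj0; apply/eqP; rewrite -[RHS]hc; apply: sV_sum.
by rewrite yE subrr; apply: idl0.
Qed.

Definition max_sym2 : submodClosed (sym2 V) :=
  spanS (fun x => exists (r : R) (y : sym2 V), r \in m /\ x = r *: y).

Lemma card_pairs : #|{: {p : 'I_t * 'I_t | (p.2 <= p.1)%N}}| = 'C(t.+1, 2).
Proof.
rewrite card_sig -sum1_card.
rewrite -(pair_big_dep predT (fun i j : 'I_t => (j <= i)%N) (fun _ _ => 1%N)) /=.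
rewrite -bin2_sum big_nat_recl // add0n big_mkord; apply: eq_bigr => i _.
rewrite -(big_ord_widen_cond t predT (fun _ => 1%N) (ltn_ord i)) /=.
by rewrite sum_nat_const card_ord muln1.
Qed.

Definition sV2 (p : {p : 'I_t * 'I_t | (p.2 <= p.1)%N}) : sym2 V :=
  sym2_mk (sV (val p).1) (sV (val p).2).

Lemma sV2_gen (A : submodClosed (sym2 V)) : (forall p, sV2 p \in A) -> forall x, x \in A.
Proof.
move=> hA; apply: (@sym2_gens _ _ [seq sV i | i <- enum 'I_t]) => [B hB x|x y].
  have [c ->] := sV_gen x; apply: rpred_sum => i _; apply: rpredZ.
  by apply: hB; apply/mapP; exists i; rewrite ?mem_enum.
move=> /mapP[i _ ->] /mapP[j _ ->]; have [ji|/ltnW ij] := leqP j i.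
  by apply: (hA (exist (fun p : 'I_t * 'I_t => (p.2 <= p.1)%N) (i, j) ji)).
rewrite sym2_mkC.
by apply: (hA (exist (fun p : 'I_t * 'I_t => (p.2 <= p.1)%N) (j, i) ij)).
Qed.

Lemma sV2_span x : exists c : _ -> R, x = \sum_p c p *: sV2 p.
Proof.
pose P x := `[< exists c : _ -> R, x = \sum_p c p *: sV2 p >].
have cl : submod_closed P.
  split; first by apply/asboolP; exists (fun _ => 0); rewrite big1 // => p _; rewrite scale0r.
  move=> r u v /asboolP[c ->] /asboolP[e ->]; apply/asboolP.
  exists (fun p => r * c p + e p); rewrite scaler_sumr -big_split /=.
  by apply: eq_bigr => p _; rewrite scalerDl scalerA.
apply/asboolP; apply: (sV2_gen (A := mk_submod cl)) => p; apply/asboolP.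
exists (fun p' => (p' == p)%:R); rewrite (bigD1 p) //= eqxx scale1r big1 ?addr0 // => p'.
by move=> /negbTE->; rewrite scale0r.
Qed.

(* The coefficient of x_i x_j, for i >= j, in the symmetric square of the
   residue space of V. *)
Lemma coefficient_form i j : exists G : {linear sym2 V -> quot_mod m},
  forall u v (p q : 'I_t -> R), u = \sum_i p i *: sV i -> v = \sum_i q i *: sV i ->
  G (sym2_mk u v) =
    quot_proj m (p i * q j + (if i == j then 0 else p j * q i) : R^o).
Proof.
have [c hc] := choice sV_gen.
pose F u v := quot_proj m (c u i * c v j + (if i == j then 0 else c u j * c v i) : R^o).
(* Coordinates on the [sV i] are unique only modulo m, hence the values in R / m. *)
have cE u (p : 'I_t -> R) l : u = \sum_i p i *: sV i -> c u l - p l \in m.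
  move=> hu; apply: (sV_indep (c := fun i => c u i - p i)).
  under eq_bigr do rewrite scalerBl.
  by rewrite sumrB -hc -hu subrr.
have FE u v (p q : 'I_t -> R) : u = \sum_i p i *: sV i -> v = \sum_i q i *: sV i ->
    F u v = quot_proj m (p i * q j + (if i == j then 0 else p j * q i) : R^o).
  move=> hu hv; apply/quot_proj_eq.
  have h l l' : c u l * c v l' - p l * q l' \in m.
    have -> : c u l * c v l' - p l * q l' =
       (c u l - p l) * c v l' + p l * (c v l' - q l') by ring.
    by apply: idlD; [apply: idlMr|apply: idlMl]; apply: cE.
  rewrite opprD addrACA; apply: idlD; first exact: h.
  by case: eqP => _; [rewrite subrr; apply: idl0|apply: h].
have [G hG] : exists G : {linear sym2 V -> quot_mod m}, forall u v, G (sym2_mk u v) = F u v.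
  apply: sym2_lift_ex => [v r u u'|u v].
    rewrite (FE _ _ (fun l => r * c u l + c u' l) (c v)) //; last first.
      rewrite {1}(hc u) {1}(hc u') scaler_sumr -big_split /=.
      by apply: eq_bigr => l _; rewrite scalerDl scalerA.
    rewrite /F -quot_proj_scale -quot_projD; congr (quot_proj m _).
    have ringE (b : bool) (x y x' y' e f : R) :
        (r * x + x') * e + (if b then 0 else (r * y + y') * f) =
        r * (x * e + (if b then 0 else y * f)) + (x' * e + (if b then 0 else y' * f)).
      by case: b; ring.
    exact: ringE.
  rewrite /F; congr (quot_proj m _).
  have symE (x y e f : R) : x * f + y * e = e * y + f * x by ring.
  by case: eqVneq => [->|_]; [rewrite mulrC|apply: symE].
by exists G => u v p q hu hv; rewrite hG; apply: FE.
Qed.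

(** The products x_i x_j with i >= j span, and [coefficient_form] reads off each of their
    coefficients modulo m, since its values are killed by m. *)
Lemma ilen_sym2_residue : ilen max_sym2 (fullS (sym2 V)) 'C(t.+1, 2).
Proof.
rewrite -card_pairs -[X in ilen _ _ X]muln1.
apply: (@ilen_free _ _ _ sV2 _ _ m) => //.
- exact: ilen_local.
- by move=> x _; have [c ->] := sV2_span x; exists c; rewrite subrr rpred0.
- by move=> p r rm; apply: mem_spanS; exists r, (sV2 p).
- move=> c hc [[i j] /= ji].
  have [G hG] := coefficient_form i j.
  have GA : {subset max_sym2 <= kerS G}.
    apply: spanS_sub => _ [r [y [rm ->]]]; rewrite mem_kerS linearZ /=.
    by rewrite -[G y]quot_proj_repr -quot_proj_scale quot_proj0; apply: idlMr.
  have sVE (l : 'I_t) : sV l = \sum_i (i == l)%:R *: sV i.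
    by rewrite (bigD1 l) //= eqxx scale1r big1 ?addr0 // => i' /negbTE->; rewrite scale0r.
  move: hc => /GA; rewrite mem_kerS linear_sum.
  rewrite (bigD1 (exist (fun p : 'I_t * 'I_t => (p.2 <= p.1)%N) (i, j) ji)) //= big1; last first.
    move=> [[k l] /= lk] ne; rewrite linearZ /= (hG _ _ _ _ (sVE _) (sVE _)).
    suff -> : ((i == k)%:R * (j == l)%:R + (if i == j then 0 else (j == k)%:R * (i == l)%:R) : R) = 0.
      by rewrite linear0 scaler0.
    have h1 : (i == k) && (j == l) = false.
      by apply/negP => /andP[/eqP e1 /eqP e2]; case/negP: ne; rewrite -val_eqE /= e1 e2.
    rewrite -natrM mulnb h1 add0r; case: eqVneq => // ij.
    (* The swapped product would require j = k and i = l; with l <= k and j <= i this forces i =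
       j. *)
    rewrite -natrM mulnb; case: eqP => //= jk; case: eqP => //= il.
    by case/negP: ij; rewrite -val_eqE eqn_leq /= ji andbT il jk.
  rewrite addr0 linearZ /= (hG _ _ _ _ (sVE _) (sVE _)) !eqxx mulr1.
  have -> : (1 + (if i == j then 0 else (j == i)%:R * (i == j)%:R) : R) = 1.
    by rewrite [j == i]eq_sym; case: eqP => _; rewrite ?mulr0 addr0.
  by rewrite -quot_proj_scale quot_proj0 [_ *: _]mulr1.
Qed.

Lemma finite_sym2 N : ilen J (fullS R^o) N ->
  exists r, ilen (zeroS (sym2 V)) (fullS (sym2 V)) r.
Proof.
move=> hN; apply: (ilen_fg (s := [seq sV2 p | p <- enum {: {p : 'I_t * 'I_t | (p.2 <= p.1)%N}}]) hN).
  move=> x r rJ; have [c ->] := sV2_span x.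
  rewrite mem_zeroS scaler_sumr big1 // => p _.
  rewrite scalerA mulrC -scalerA -sym2_mkZl.
  suff -> : r *: sV (val p).1 = 0.
    by rewrite -[sym2_mk _ _]/(sym2_left _ _) linear0 scaler0.
  apply/eqP; rewrite /sV -linearZ subquo_proj0.
  exact: idlMr.
move=> B _ hB x; apply: sV2_gen => p; apply: hB; apply/mapP.
by exists p; rewrite ?mem_enum.
Qed.

End Sym2Residue.

(** * Assembly of the length formulas *)

Lemma minimal_generators_size (R : comNzRingType) (m I : ideal R) (u v : seq R) :
  noetherian R -> local_ring m ->
  minimal_generators u I -> minimal_generators v I -> size u = size v.
Proof.
move=> noe loc hu hv.
have hu' := ilen_minimal_generators noe loc (u := [::]) hu.
have hv' := ilen_minimal_generators noe loc (u := [::]) hv.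
exact: ilen_inj hu' hv'.
Qed.

Theorem proposition3p3 (R : comNzRingType) (m : ideal R) (d s k : nat)
    (z : d.-tuple R) :
  gorenstein_local m ->
  krull_dim R d ->
  (2 <= d)%N ->
  (2 <= s)%N ->
  regular_sequence z ->
  (forall i : 'I_d, tnth z i \in ideal_exp m s) ->
  (forall j : nat, (3 <= j <= s)%N ->
     colon (ideal_exp m j) m =i ideal_exp m j.-1) ->
  (1 <= k <= s)%N ->
  let J : ideal R := ideal_gen z in
  let I : ideal R := colon J (ideal_exp m k) in
  among_minimal_generators z I ->
  let nk : nat := mlength (subquo (ideal_exp m k.-1) (ideal_exp m k)) in
  let S2IJ : lmodType R := sym2 (subquo I J) in
  let rho : nat := mlength S2IJ in
  [/\ (* all the lengths involved are finite *)
      [/\ finite_length (subquo (ideal_exp m k.-1) (ideal_exp m k)),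
          finite_length S2IJ,
          finite_length (quot_mod I)
        & finite_length (quot_mod (ideal_exp m k))],
      (* (a) *)
      [/\ finite_length (subquo (ideal_mul I I) (ideal_mul J I)),
          finite_length (delta I)
        & rho = (mlength (subquo (ideal_mul I I) (ideal_mul J I))
                 + mlength (delta I))%N],
      (* (b) *)
      (forall (n : nat) (a : n.-tuple R), minimal_generators a I ->
         finite_length (koszul_H a 1) /\
         ((mlength (koszul_H a 1))%:Z =
            (nk * mlength (quot_mod I))%:Z + rho%:Z
            - (mlength (quot_mod (ideal_exp m k)))%:Z)%R)
    & (* moreover *)
      (rho = 'C(nk.+1, 2)) <->
      (forall (r : R) (v : S2IJ), r \in m -> r *: v = 0)].
Proof.
move=> gor kd d2 s2 zreg zm hcol ks J I [w minI] nk S2IJ rho.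
have [noe loc _] := gor; have [zr J1] := zreg.
have sz : size z = d by rewrite size_tuple.
have type1 := gorenstein_type1 gor kd zreg sz.
have hJ := regular_primes zr noe loc kd sz.
set Q := ideal_exp m k; rewrite -/J in type1 hJ.
have Jexp j : (j <= s)%N -> {subset J <= ideal_exp m j}.
  move=> js; apply: gen_sub => x /tnthP[i ->]; exact: exp_idl_sub js _ (zm i).
have [k1 kls] := andP ks.
have JQ : {subset J <= Q} by apply: Jexp.
have JI : {subset J <= I} by exact: sub_colon.
have QQ : {subset Q <= ideal_exp m k.-1} by apply: exp_idl_sub; apply: leq_pred.
have eQ : colon Q m =i ideal_exp m k.-1.
  apply: (exp_colon noe loc zreg hJ _ (Jexp 2%N s2) hcol ks).
  by rewrite sz (leq_trans _ d2).
have [N hN] := ilen_artin noe loc hJ (fun x (h : x \in J) => h).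
have [lQ hQ] := ilen_artin noe loc hJ JQ.
have [L hL] := ilen_artin noe loc hJ JI.
have [n0 [? [hn0 _ _]]] := ilen_split QQ (@sub_fullS _ _ _) hQ.
have nkE : has_length (subquo (ideal_exp m k.-1) Q) n0 by apply/ilen_subquo.
have QE : has_length (quot_mod Q) lQ by apply/ilen_quot_mod.
have IE : has_length (quot_mod I) L by apply/ilen_quot_mod.
have [r hr] := finite_sym2 minI hN.
have rE : has_length S2IJ r by apply/has_lengthP.
have hI : ilen J I lQ := colon_power_ilen noe loc hJ type1 JQ hQ.
have wn0 : size w = n0.
  have h := ilen_minimal_generators noe loc minI; apply: ilen_inj h _.
  apply: (colon_generators_ilen noe loc hJ type1 JQ (@sub_colon _ _ _)).
  by apply: ilen_eq hn0 => // x; rewrite eQ.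
have [b' [b [hb' hb rbb]]] := ilen_sym2_quotient zr JI hr.
have JII : {subset ideal_mul J I <= ideal_mul I I}.
  by apply: mul_idl_sub => x y /JI xI yI; apply: mul_idl.
have bE : has_length (subquo (ideal_mul I I) (ideal_mul J I)) b by apply/ilen_subquo.
have dE : has_length (delta I) b' by apply/ilen_sub_mod.
rewrite /rho (mlengthE rE) /nk (mlengthE nkE) (mlengthE IE) (mlengthE QE).
rewrite (mlengthE bE) (mlengthE dE).
split.
- by split; [exists n0|exists r|exists L|exists lQ].
- by split; [exists b|exists b'|rewrite rbb addnC].
- move=> n a mina.
  have na : n = (d + n0)%N.
    have := minimal_generators_size noe loc mina minI.
    by rewrite size_cat size_tuple sz wn0.
  have [e [f [he hf nef]]] := ilen_syzygies mina.1 hL.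
  have hH : ilen (koszul_bd a) (syzygies a) (b' + e).
    apply: ilen_add (iffLR (ilen_delta mina.1 _) hb') he.
      by move=> v vb; rewrite mem_capS koszul_bd_syz ?(koszul_bd_coef mina.1).
    by move=> v; rewrite mem_capS => /andP[].
  have HE : has_length (koszul_H a 1) (b' + e) by apply/ilen_koszul_H1.
  split; first by exists (b' + e)%N.
  rewrite (mlengthE HE).
  (* The two ways from JI to I, through J and through I^2; [nef] and [na] then eliminate [f]. *)
  have h1 := ilen_add (@mul_idl_subl _ J I) JI (ilen_regular zr JI hL) hI.
  have h2 := ilen_add JII (@mul_idl_subl _ I I) hb hf.
  have := ilen_inj h1 h2; rewrite sz; nia.
- have hres := ilen_sym2_residue noe loc minI.
  rewrite -/J wn0 in hres.
  (* [e] is the length of m S_2(I/J), so the numerical condition amounts to e = 0. *)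
  have [e [f [he hf ref]]] := ilen_split (@zeroS_sub _ _ _) (@sub_fullS _ _ _) hr
    : exists e f, [/\ ilen _ (max_sym2 m z I) e, _ & _].
  have fE := ilen_inj hf hres; subst f.
  rewrite ref; split=> [e0 x v xm|kill].
    have {}e0 : e = 0%N by lia.
    rewrite e0 in he; apply/eqP; rewrite -mem_zeroS.
    by apply: (ilen0P (@zeroS_sub _ _ _) he); apply: mem_spanS; exists x, v.
  have h0 : ilen (zeroS S2IJ) (max_sym2 m z I) 0.
    apply: ilen0; first exact: zeroS_sub.
    by apply: spanS_sub => _ [x [v [xm ->]]]; rewrite mem_zeroS kill.
  by rewrite (ilen_inj he h0).
Qed.
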